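(* Let $w_p$ be the unique root in $(0,1)$ of $w^p+1=2(1-w)^p$, and define $$s_p=\begin{cases}\left(\left(2^p-1\right)^{\frac{1}{p-1}}+1\right)^{-1/p}, & p\in(1,2],\\ \left(w_p^{p/(p-1)}+1\right)^{-1/p}, & p\in(2,\infty).\end{cases}$$ For $p\in(1,2]$ let $e^-_p=\pi_p+2\int_0^{s_p}\left(z^{p^2-p}(1-z^p)^{1-p}+1\right)^{1/p}dz$ and $\gamma^-_p=2(1-s_p^p)^{1/p}$. For $p\in[2,\infty)$ let $e^+_p=\pi_p+2\int_{2^{-1/p}}^{s_p}\left(z^{p^2-p}(1-z^p)^{1-p}+1\right)^{1/p}dz$ and $\gamma^+_p=2^{1/p}\left((1-s_p^p)^{1/p}+s_p\right)$. Then for every $p\in(1,2]$, the placement of the exit inducing the worst case cost of Wireless-Search$_p(0)$ is such that, when it is found, the total explored portion of $\mathcal C_p$ has measure $e^-_p$ (i.e. it is found after parallel search time $\tau=e^-_p/2$), and at that moment the robots are at $\ell_p$ distance $\gamma^-_p$. For every $p\in[2,\infty)$, the placement of the exit inducing the worst case cost of Wireless-Search$_p(\pi/4)$ is such that, when it is found, the total explored portion of $\mathcal C_p$ has measure $e^+_p$, and at that moment the robots are at distance $\gamma^+_p$. Moreover, setting $e_p=e^-_p$ for $p\le 2$ and $e_p=e^+_p$ for $p>2$, we have $e_p\in(\pi_p,2\pi_p]$.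
   Context: For $p\in[1,\infty)$ and $x=(x_1,x_2)\in\mathbb{R}^2$, $\|x\|_p=(|x_1|^p+|x_2|^p)^{1/p}$, $d_p(x,y)=\|x-y\|_p$, and $\mathcal C_p=\{x:\|x\|_p=1\}$. Lengths of curves are $\ell_p$ lengths $\int\|r'(t)\|_p\,dt$. Let $N_p(\phi)=(|\sin\phi|^p+|\cos\phi|^p)^{1/p}$, $\rho_p(\phi)=(\cos\phi/N_p(\phi),\sin\phi/N_p(\phi))$. For $U\subseteq\mathcal C_p$, $\mu_p(U)=\sum_{i=1}^4\int_{t\in Q_i:\rho_p(t)\in U}\|\rho_p'(t)\|_p\,dt$ with $Q_1=[0,\pi/2),Q_2=[\pi/2,\pi),Q_3=[\pi,3\pi/2),Q_4=[3\pi/2,2\pi)$, and $\pi_p=\mu_p(\mathcal C_p)/2$. Problem: two unit-speed robots start at the origin; an exit is at an unknown point of $\mathcal C_p$; once a robot reaches the exit the other robot learns it instantly; evacuation time is when both robots have reached the exit; cost of an algorithm is its worst case (supremum over exit positions) evacuation time. Algorithm Wireless-Search$_p(\phi)$: both robots move straight to $\rho_p(\phi)$ (time 1); then robot 1 follows $\rho_p(\phi+t)$ and robot 2 follows $\rho_p(\phi-t)$, $t\ge0$, each along $\mathcal C_p$ at unit $\ell_p$ speed, until the exit is found; then the finder stays and the other moves straight to it. Parallel search time $\tau$ is measured from the moment the robots reach $\rho_p(\phi)$; the explored portion after time $\tau$ has measure $2\tau$.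
   Formalization: At p=2 the printed first branch gives s_2=1/2, making e^+_2=5π/6 and γ^+_2 false (the true worst case has explored measure 4π/3 and distance √3); in e^+_p and γ^+_p the second branch of s_p, with w_p, is used at p=2 too. *)

(* Defs.v *)
From HB Require Import structures.
From mathcomp Require Import all_boot all_order all_algebra.
From mathcomp Require Import all_classical all_reals all_analysis.

Set Implicit Arguments.
Unset Strict Implicit.
Unset Printing Implicit Defensive.

Import Order.TTheory GRing.Theory Num.Theory.
Import numFieldNormedType.Exports.

Local Open Scope classical_set_scope.
Local Open Scope ring_scope.

Section Geometry.
Context {R : realType}.
Implicit Types (p t : R) (x y : R * R).

Definition lp_norm p x : R := (`|x.1| `^ p + `|x.2| `^ p) `^ p^-1.

Definition lp_dist p x y : R := lp_norm p (x - y).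

Definition lp_circle p : set (R * R) := [set x | lp_norm p x = 1].

Definition N_p p (phi : R) : R := (`|sin phi| `^ p + `|cos phi| `^ p) `^ p^-1.

Definition rho p (phi : R) : R * R := (cos phi / N_p p phi, sin phi / N_p p phi).

(* [lp_norm p (r' t)], with the derivative taken componentwise. *)
Definition lp_speed p (r : R -> R * R) t : R :=
  lp_norm p (derive1 (fun s => (r s).1) t, derive1 (fun s => (r s).2) t).

Definition lp_length p (r : R -> R * R) (a b : R) : \bar R :=
  (\int[lebesgue_measure]_(t in `[a, b]) (lp_speed p r t)%:E)%E.

(* Q_1, ..., Q_4 are [quadrant 0], ..., [quadrant 3]. *)
Definition quadrant (i : nat) : set R :=
  `[i%:R * (pi / 2), i.+1%:R * (pi / 2)[.

Definition mu_p p (U : set (R * R)) : \bar R :=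
  (\sum_(i < 4) \int[lebesgue_measure]_(t in quadrant i `&` (rho p @^-1` U))
      (lp_speed p (rho p) t)%:E)%E.

Definition pi_p p : R := fine (mu_p p (lp_circle p)) / 2.

End Geometry.

Section WirelessSearch.
Context {R : realType}.
Implicit Types (p phi tau T : R) (x a b exit : R * R).

(* The curve [t |-> r t], t >= 0, traversed at unit l_p speed: the point reached
   at time [tau] is the one at which the length covered so far is [tau]. *)
Definition unit_speed p (r : R -> R * R) tau : R * R :=
  r (xget 0 [set t | 0 <= t /\ lp_length p r 0 t = tau%:E]).

Definition straight p a b T : R * R :=
  if T < lp_dist p a b then a + (T / lp_dist p a b) *: (b - a) else b.

Definition search1 p phi : R -> R * R :=
  unit_speed p (fun t => rho p (phi + t)).

Definition search2 p phi : R -> R * R :=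
  unit_speed p (fun t => rho p (phi - t)).

(* The parallel search time at which the exit is found. *)
Definition found_time p phi exit : R :=
  inf [set tau | 0 <= tau /\ (search1 p phi tau = exit \/
                              search2 p phi tau = exit)].

Definition explored p phi tau : set (R * R) :=
  search1 p phi @` `[0, tau] `|` search2 p phi @` `[0, tau].

(* Position at time [T], counted from the departure from the origin, of the robot
   that searches along [search].  For the finder the last phase is a motion from
   [exit] to itself, i.e. it stays there. *)
Definition trajectory p phi (search : R -> R * R) exit T : R * R :=
  let tau := found_time p phi exit in
  if T < 1 then straight p 0 (rho p phi) T
  else if T < 1 + tau then search (T - 1)
  else straight p (search tau) exit (T - (1 + tau)).

Definition evacuation_time p phi exit : R :=
  inf [set T | [/\ 0 <= T,
                   trajectory p phi (search1 p phi) exit T = exit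
                 & trajectory p phi (search2 p phi) exit T = exit]].

Definition cost p phi : \bar R :=
  ereal_sup [set (evacuation_time p phi exit)%:E | exit in lp_circle p].

Definition worst_case_exits p phi : set (R * R) :=
  [set exit | lp_circle p exit /\ (evacuation_time p phi exit)%:E = cost p phi].

Definition found_distance p phi exit : R :=
  let tau := found_time p phi exit in
  lp_dist p (search1 p phi tau) (search2 p phi tau).

End WirelessSearch.

Section Values.
Context {R : realType}.
Implicit Types (p z : R).

Definition w_roots p : set R :=
  [set w | 0 < w < 1 /\ w `^ p + 1 = 2 * (1 - w) `^ p].

Definition w_p p : R := xget 0 (w_roots p).

(* The branches of s_p for p <= 2 and for p >= 2.  They disagree at p = 2, where
   [s_minus 2 = 1 / 2] and [s_plus 2 = sqrt (2 + sqrt 3) / 2]; the search started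
   at angle pi / 4 needs the second one there, so [e_plus] and [gamma_plus] use
   [s_plus] also at p = 2. *)
Definition s_minus p : R :=
  ((2 `^ p - 1) `^ (p - 1)^-1 + 1) `^ (- p^-1).

Definition s_plus p : R :=
  (w_p p `^ (p / (p - 1)) + 1) `^ (- p^-1).

Definition arc_density p z : R :=
  (z `^ (p ^+ 2 - p) * (1 - z `^ p) `^ (1 - p) + 1) `^ p^-1.

Definition e_minus p : R :=
  pi_p p + 2 * \int[lebesgue_measure]_(z in `[0, s_minus p]) arc_density p z.

(* Since [w_p p < 1], the lower bound [2 `^ (- p^-1)] is less than [s_plus p]. *)
Definition e_plus p : R :=
  pi_p p +
  2 * \int[lebesgue_measure]_(z in `[2 `^ (- p^-1), s_plus p]) arc_density p z.

Definition gamma_minus p : R := 2 * (1 - s_minus p `^ p) `^ p^-1.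

Definition gamma_plus p : R :=
  2 `^ p^-1 * ((1 - s_plus p `^ p) `^ p^-1 + s_plus p).

Definition e_p p : R := if p <= 2 then e_minus p else e_plus p.

End Values.

(* Main.v *)
Require Import Defs.
From HB Require Import structures.
From mathcomp Require Import all_boot all_order all_algebra.
From mathcomp Require Import all_classical all_reals all_analysis.
From mathcomp Require Import measurable_realfun ring lra.

Set Implicit Arguments.
Unset Strict Implicit.
Unset Printing Implicit Defensive.

Import Order.TTheory GRing.Theory Num.Theory.
Import numFieldNormedType.Exports.

Local Open Scope classical_set_scope.
Local Open Scope ring_scope.

(* With sg(a) = |a|^(p-1) sign(a) and D = |sin|^p + |cos|^p, the derivative of
   rho_p is D^(-1/p-1) (- sg(sin), sg(cos)).  Hence the l_p speed v of rho_p is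
   continuous, positive, even and pi/2-periodic, and the arc length has a global
   primitive A with A' = v.  Started at phi = 0 or pi/4 the robots are mirror
   images of each other, so after rotating by t each they have searched for time
   A(phi+t) - A(phi), and the evacuation time of an exit found then is
   1 + A(phi+t) - A(phi) + d(t), with d the distance between the robots.  Up to the
   positive factor D^(-1/p-1), the derivative of this cost is, with x = sg(sin)
   and y = sg(cos) at angle phi+t,
     ||(x,y)||_p + 2 y              for phi = 0,
     ||(x,y)||_p + 2^(1/p) (x+y)    for phi = pi/4,
   and for 0 < t < pi both have the sign of k y + x, where k = (2^p-1)^(1/p),
   resp. k = w_p.  That changes sign once, at the angle pi - atan(k^(1/(p-1))), so the cost has a
   unique maximum there.  The substitution z = - cos/N_p turns the arc length into
   the integral of arc_density. *)

(** * Signed powers and the derivative of rho *)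

Section SignedPower.
Context {R : realType}.
Implicit Types p q x : R.

(** The odd extension of the power function; for q = p - 1 it is 1/p times the derivative of
    |x|^p. *)
Definition spow q x : R := Num.sg x * `|x| `^ q.

Lemma continuous_norm_powR q : 0 < q -> continuous (fun x : R => `|x| `^ q).
Proof.
move=> q0 x; have [->|x0] := eqVneq x 0.
  apply/cvgrPdist_lt => e e0.
  (* At 0 the radius e^(1/q) works, since |y| < e^(1/q) gives |y|^q < e. *)
  have := @nbhs0_lt R R^o _ (powR_gt0 q^-1 e0); apply: filterS => y ye.
  rewrite normr0 powR0 ?gt_eqF// sub0r normrN ger0_norm ?powR_ge0//.
  rewrite -(powRr1 (ltW e0)) -(mulVf (lt0r_neq0 q0)) powRrM.
  by apply: gt0_ltr_powR; rewrite ?nnegrE ?powR_ge0.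
suff: {for x, continuous ((fun y : R => y `^ q) \o (fun y : R => `|y|))} by [].
apply: continuous_comp; first exact: (@norm_continuous R R^o).
apply/differentiable_continuous/derivable1_diffP/derivable_powR.
by rewrite in_itv/= andbT normr_gt0.
Qed.

(** Away from 0 the function is locally a power of y or of -y. At 0 the difference quotient has
    absolute value |h|^(p-1), which tends to 0 because p > 1. *)
Lemma is_derive_norm_powR p x : 1 < p ->
  is_derive x 1 (fun y : R => `|y| `^ p) (p * spow (p - 1) x).
Proof.
move=> p1; rewrite /spow; have [x0|x0|->] := ltgtP x 0.
- apply: (@near_eq_is_derive _ _ _ (fun y => (- y) `^ p)).
    near=> y; rewrite ltr0_norm//; near: y; exact: lt_nbhsl.
  rewrite ltr0_sg// ltr0_norm//.
  have nx : 0 < - x by rewrite oppr_gt0.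
  pose i := @is_derive1_comp _ (fun y : R => y `^ p) -%R x _ _
    (is_derive1_powR p nx) (is_deriveNid x 1).
  by apply: (is_derive_eq i); ring.
- apply: (@near_eq_is_derive _ _ _ (fun y => y `^ p)).
    near=> y; rewrite gtr0_norm//; near: y; exact: lt_nbhsr.
  rewrite gtr0_sg// gtr0_norm//.
  by rewrite mul1r; exact: is_derive1_powR.
- rewrite sgr0 mul0r mulr0.
  have h : h^-1 *: (`|h| `^ p - `|(0:R)| `^ p) @[h --> (0 : R)^'] --> (0 : R).
    apply/cvgr0Pnorm_lt => e e0; near=> h.
    have h0 : h != 0 by near: h; exact: nbhs_dnbhs_neq.
    rewrite normr0 powR0 ?gt_eqF ?(lt_trans ltr01)// subr0 normrZ normfV.
    rewrite [X in _ * X]ger0_norm ?powR_ge0//.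
    rewrite -(mulr_powRB1 (normr_ge0 h)) ?(lt_trans ltr01)// mulKf ?normr_eq0//.
    near: h; apply: nbhs_dnbhs.
    have q0 : 0 < p - 1 by rewrite subr_gt0.
    have /cvgrPdist_lt := @continuous_norm_powR _ q0 0 => /(_ _ e0).
    apply: filterS => y; rewrite normr0 powR0 ?gt_eqF// sub0r normrN.
    by rewrite ger0_norm ?powR_ge0.
  apply: DeriveDef; last first.
    rewrite /derive; apply/cvg_lim => //; apply: cvg_trans h.
  by apply: near_eq_cvg; near=> y; rewrite /comp /shift/= addr0 [y%:A]mulr1.
  apply/cvg_ex; exists 0; apply: cvg_trans h.
  by apply: near_eq_cvg; near=> y; rewrite /comp /shift/= addr0 [y%:A]mulr1.
Unshelve. all: by end_near. Qed.

Lemma spow_mul p x : 0 < p -> spow (p - 1) x * x = `|x| `^ p.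
Proof.
by move=> p0; rewrite /spow mulrAC -normrEsg mulr_powRB1.
Qed.

Lemma spowN q x : spow q (- x) = - spow q x.
Proof. by rewrite /spow sgrN normrN mulNr. Qed.

Lemma norm_spow q x : 0 < q -> `|spow q x| = `|x| `^ q.
Proof.
move=> q0; rewrite /spow normrM normr_sg [X in _ * X]ger0_norm ?powR_ge0//.
by have [->|_] := eqVneq x 0; rewrite ?mul1r// normr0 powR0 ?gt_eqF// mulr0.
Qed.

Lemma spow_gt0 q x : 0 < x -> spow q x = x `^ q.
Proof. by move=> x0; rewrite /spow gtr0_sg// mul1r gtr0_norm. Qed.

Lemma spow_ge0 q x : 0 < q -> 0 <= x -> spow q x = x `^ q.
Proof.
move=> q0; rewrite le_eqVlt => /predU1P[<-|/spow_gt0->//].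
by rewrite /spow sgr0 mul0r powR0 ?gt_eqF.
Qed.

End SignedPower.

(** * Derivative and speed of the parametrisation [rho] *)

Section Rho.
Context {R : realType}.
Implicit Types p t x : R.

Definition Dp p x : R := `|sin x| `^ p + `|cos x| `^ p.

Lemma Dp_gt0 p x : 0 < Dp p x.
Proof.
rewrite /Dp; have [s0|s0] := eqVneq (sin x) 0.
  rewrite ltr_wpDl ?powR_ge0// powR_gt0// normr_gt0.
  by rewrite -normr_eq0 sin0cos1// oner_neq0.
by rewrite ltr_pwDl ?powR_ge0// powR_gt0// normr_gt0.
Qed.

Lemma N_pE p x : N_p p x = Dp p x `^ p^-1. Proof. by []. Qed.

Lemma is_derive_Dp p x : 1 < p ->
  is_derive x 1 (Dp p)
    (p * (spow (p - 1) (sin x) * cos x - spow (p - 1) (cos x) * sin x)).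
Proof.
move=> p1.
pose ds := @is_derive1_comp _ (fun y => `|y| `^ p) sin x _ _
  (is_derive_norm_powR (sin x) p1) (is_derive_sin x).
pose dc := @is_derive1_comp _ (fun y => `|y| `^ p) cos x _ _
  (is_derive_norm_powR (cos x) p1) (is_derive_cos x).
by apply: (is_derive_eq (is_deriveD ds dc)); ring.
Qed.

Lemma is_derive_Dpow p x r : 1 < p ->
  is_derive x 1 (fun y => Dp p y `^ r)
    (r * Dp p x `^ (r - 1) *
    (p * (spow (p - 1) (sin x) * cos x - spow (p - 1) (cos x) * sin x))).
Proof.
move=> p1.
exact: (@is_derive1_comp _ (fun y : R => y `^ r) (Dp p) x _ _
  (is_derive1_powR r (Dp_gt0 p x)) (is_derive_Dp x p1)).
Qed.

Definition wp p x : R := Dp p x `^ (- p^-1 - 1).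

Lemma wp_gt0 p x : 0 < wp p x. Proof. by rewrite powR_gt0 ?Dp_gt0. Qed.

Lemma rhoE p x :
  rho p x = (cos x * Dp p x `^ (- p^-1), sin x * Dp p x `^ (- p^-1)).
Proof. by rewrite /rho N_pE !powRN. Qed.

(** Splits off one factor D, written through signed powers, so that [wp] factors out of both
    components of the derivative of [rho]. *)
Lemma Dp_wp p x : 1 < p -> Dp p x `^ (- p^-1) =
  wp p x * (spow (p - 1) (sin x) * sin x + spow (p - 1) (cos x) * cos x).
Proof.
move=> p1; rewrite !spow_mul ?(lt_trans ltr01)// -[_ + _]/(Dp p x).
have D0 := Dp_gt0 p x.
by rewrite /wp -[X in _ * X](powRr1 (ltW D0)) -powRD subrK ?(gt_eqF D0) ?implybT.
Qed.

Lemma is_derive_rho1 p x : 1 < p ->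
  is_derive x 1 (fun t => (rho p t).1) (- (wp p x * spow (p - 1) (sin x))).
Proof.
move=> p1; have p0 : p != 0 by rewrite gt_eqF ?(lt_trans ltr01).
rewrite (_ : (fun t => _) = (cos * (fun y => Dp p y `^ (- p^-1)))); last first.
  by apply/funext => t; rewrite rhoE.
apply: (is_derive_eq (is_deriveM (is_derive_cos x) (is_derive_Dpow x _ p1))).
rewrite /GRing.scale/= (Dp_wp _ p1) -/(wp p x).
have := cos2Dsin2 x; set c := cos x; set s := sin x => cs.
(* The left side is the claimed value times cos^2 + sin^2; expanding the 1 on the right makes this a
   field identity. *)
rewrite -[RHS]mulr1 -cs; field; exact: p0.
Qed.

Lemma is_derive_rho2 p x : 1 < p ->
  is_derive x 1 (fun t => (rho p t).2) (wp p x * spow (p - 1) (cos x)).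
Proof.
move=> p1; have p0 : p != 0 by rewrite gt_eqF ?(lt_trans ltr01).
rewrite (_ : (fun t => _) = (sin * (fun y => Dp p y `^ (- p^-1)))); last first.
  by apply/funext => t; rewrite rhoE.
apply: (is_derive_eq (is_deriveM (is_derive_sin x) (is_derive_Dpow x _ p1))).
rewrite /GRing.scale/= (Dp_wp _ p1) -/(wp p x).
have := cos2Dsin2 x; set c := cos x; set s := sin x => cs.
rewrite -[RHS]mulr1 -cs; field; exact: p0.
Qed.

Definition speed p x : R := lp_speed p (rho p) x.

Lemma lp_norm_scale p k x y : p != 0 -> 0 <= k ->
  lp_norm p (k * x, k * y) = k * lp_norm p (x, y).
Proof.
move=> p0 k0; rewrite /lp_norm/= !normrM (ger0_norm k0) !powRM//.
rewrite -mulrDr powRM ?addr_ge0 ?powR_ge0// -powRrM mulfV// powRr1//.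
Qed.

Lemma lp_normN1 p x y : lp_norm p (- x, y) = lp_norm p (x, y).
Proof. by rewrite /lp_norm/= normrN. Qed.

Lemma lp_normN2 p x y : lp_norm p (x, - y) = lp_norm p (x, y).
Proof. by rewrite /lp_norm/= normrN. Qed.

Lemma lp_normC p x y : lp_norm p (x, y) = lp_norm p (y, x).
Proof. by rewrite /lp_norm/= addrC. Qed.

Lemma speedE p x : 1 < p ->
  speed p x = wp p x * lp_norm p (spow (p - 1) (sin x), spow (p - 1) (cos x)).
Proof.
move=> p1; rewrite /speed /lp_speed !derive1E.
rewrite (@derive_val _ _ _ _ _ _ _ (is_derive_rho1 x p1)).
rewrite (@derive_val _ _ _ _ _ _ _ (is_derive_rho2 x p1)).
by rewrite lp_normN1 lp_norm_scale ?ltW ?wp_gt0// gt_eqF ?(lt_trans ltr01).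
Qed.

Lemma continuous_Dp p : 1 < p -> continuous (Dp p).
Proof.
move=> p1 x; apply/differentiable_continuous/derivable1_diffP.
exact: (@ex_derive _ _ _ _ _ _ _ (is_derive_Dp x p1)).
Qed.

Lemma continuous_powR_pos (T : topologicalType) (f : T -> R) r (x : T) :
  0 < f x -> {for x, continuous f} -> {for x, continuous (fun y => f y `^ r)}.
Proof.
move=> fx0 cf; apply: (@continuous_comp _ _ _ f (fun y : R => y `^ r)) => //.
apply/differentiable_continuous/derivable1_diffP/derivable_powR.
by rewrite in_itv/= andbT.
Qed.

Lemma continuous_wp p : 1 < p -> continuous (wp p).
Proof.
by move=> p1 x; apply: continuous_powR_pos; [exact: Dp_gt0|exact: continuous_Dp].
Qed.

Lemma speed_sum_gt0 p x : 1 < p ->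
  0 < `|spow (p - 1) (sin x)| `^ p + `|spow (p - 1) (cos x)| `^ p.
Proof.
move=> p1; have q0 : 0 < p - 1 by rewrite subr_gt0.
rewrite !norm_spow// -!powRrM; exact: Dp_gt0.
Qed.

Lemma continuous_speed p : 1 < p -> continuous (speed p).
Proof.
move=> p1; have q0 : 0 < p - 1 by rewrite subr_gt0.
(* As |sg(a)| = |a|^(p-1), the norm in the speed is a power of [Dp] for the exponent (p-1)p. That
   exponent may be at most 1, so only continuity of |y|^q is used. *)
rewrite (_ : speed p = (fun x => wp p x * (Dp ((p - 1) * p) x) `^ p^-1)); last first.
  apply/funext => x; rewrite (speedE x p1) /lp_norm /=.
  by rewrite !(norm_spow _ q0) -!powRrM.
move=> x; apply: continuousM; first exact: continuous_wp.
apply: continuous_powR_pos; first exact: Dp_gt0.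
apply: continuousD.
  apply: (@continuous_comp _ _ _ sin (fun y => `|y| `^ ((p - 1) * p))).
    exact: continuous_sin.
  by apply: continuous_norm_powR; rewrite mulr_gt0// (lt_trans ltr01).
apply: (@continuous_comp _ _ _ cos (fun y => `|y| `^ ((p - 1) * p))).
  exact: continuous_cos.
by apply: continuous_norm_powR; rewrite mulr_gt0// (lt_trans ltr01).
Qed.

Lemma speed_gt0 p x : 1 < p -> 0 < speed p x.
Proof.
move=> p1; rewrite (speedE _ p1) mulr_gt0 ?wp_gt0// /lp_norm powR_gt0//=.
exact: speed_sum_gt0.
Qed.

Lemma DpN p x : Dp p (- x) = Dp p x.
Proof. by rewrite /Dp sinN cosN normrN. Qed.

Lemma DpDpihalf p x : Dp p (x + pi / 2) = Dp p x.
Proof. by rewrite /Dp sinDpihalf cosDpihalf normrN addrC. Qed.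

Lemma speedN p x : 1 < p -> speed p (- x) = speed p x.
Proof.
by move=> p1; rewrite !(speedE _ p1) /wp DpN sinN cosN spowN lp_normN1.
Qed.

Lemma speedDpihalf p x : 1 < p -> speed p (x + pi / 2) = speed p x.
Proof.
move=> p1; rewrite !(speedE _ p1) /wp DpDpihalf sinDpihalf cosDpihalf spowN.
by rewrite lp_normN2 lp_normC.
Qed.

End Rho.

(** * Arc length *)

Section Primitive.
Context {R : realType}.
Notation mu := (@lebesgue_measure R).
Implicit Types x y T : R.
Variable f : R -> R.
Hypothesis cf : continuous f.

(* One of the two intervals is degenerate, depending on the sign of [x]. *)
Definition primitive x : R :=
  \int[mu]_(t in `[0, x]) f t - \int[mu]_(t in `[x, 0]) f t.

Lemma continuous_integrable_itv a b : mu.-integrable `[a, b] (EFin \o f).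
Proof.
apply: continuous_compact_integrable; first exact: segment_compact.
exact: continuous_subspaceT.
Qed.

Lemma continuous_integrable_itv_oc a b : mu.-integrable `]a, b] (EFin \o f).
Proof.
apply: (@integrableS _ _ _ mu `[a, b]) => //; last exact: continuous_integrable_itv.
exact: subset_itv_oc_cc.
Qed.

Lemma Rintegral_degenerate (x y : R) : y <= x -> \int[mu]_(t in `[x, y]) f t = 0.
Proof.
rewrite le_eqVlt => /predU1P[->|yx].
  by rewrite set_itv1 /Rintegral integral_set1.
by rewrite set_itv_ge ?Rintegral_set0// bnd_simp -ltNge.
Qed.

(** Moves the base point to the left of both 0 and x, so that near x a single integral with fixed
    lower limit remains, to which the fundamental theorem applies. *)
Lemma primitiveE (a x : R) : a < 0 -> a < x -> primitive x =
  \int[mu]_(t in `[a, x]) f t - \int[mu]_(t in `[a, 0]) f t.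
Proof.
move=> a0 ax; rewrite /primitive; have [x0|x0] := leP 0 x.
  rewrite (Rintegral_degenerate x0) subr0.
  rewrite (@Rintegral_itvB _ f _ (BRight x)) ?bnd_simp ?(ltW a0)//.
    rewrite Rintegral_itv_obnd_cbnd//; exact: continuous_integrable_itv_oc.
  exact: continuous_integrable_itv.
rewrite (Rintegral_degenerate (ltW x0)) sub0r -[RHS]opprB; congr (- _).
rewrite (@Rintegral_itvB _ f _ (BRight 0)) ?bnd_simp ?(ltW ax) ?(ltW x0)//.
  rewrite Rintegral_itv_obnd_cbnd//; exact: continuous_integrable_itv_oc.
exact: continuous_integrable_itv.
Qed.

Lemma is_derive_primitive x : is_derive x 1 primitive (f x).
Proof.
pose M := `|x| + 1; have M0 : 0 < M by rewrite ltr_wpDl.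
have Mx : - M < x < M.
  by rewrite -ltr_norml /M ltrDl.
case/andP: Mx => Mx xM.
pose G := (fun y => \int[mu]_(t in `[- M, y]) f t) -
  cst (\int[mu]_(t in `[- M, 0]) f t).
apply: (@near_eq_is_derive _ _ _ G).
  near=> y; rewrite (@primitiveE (- M)) ?oppr_lt0//.
  by near: y; exact: lt_nbhsr.
have [dF F'] := @continuous_FTC1_closed _ f (- M) x M xM
  (continuous_integrable_itv _ _) Mx (@cf x).
have d : is_derive x 1 (fun y => \int[mu]_(t in `[- M, y]) f t) (f x).
  by apply: DeriveDef; [exact: dF|rewrite -derive1E; exact: F'].
by apply: (is_derive_eq (is_deriveB d (is_derive_cst _ x 1))); rewrite subr0.
Unshelve. all: by end_near. Qed.

Lemma continuous_primitive : continuous primitive.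
Proof.
move=> x; apply/differentiable_continuous/derivable1_diffP.
exact: (@ex_derive _ _ _ _ _ _ _ (is_derive_primitive x)).
Qed.

Lemma integral_primitive (a b : R) : a <= b ->
  (\int[mu]_(x in `[a, b]) (f x)%:E = (primitive b - primitive a)%:E)%E.
Proof.
rewrite le_eqVlt => /predU1P[->|ab].
  by rewrite set_itv1 integral_set1 subrr.
rewrite (@continuous_FTC2 _ f primitive) ?EFinB//.
- exact: continuous_subspaceT.
- split.
  + by move=> x _; exact: (@ex_derive _ _ _ _ _ _ _ (is_derive_primitive x)).
  + by apply: cvg_at_right_filter; exact: continuous_primitive.
  + by apply: cvg_at_left_filter; exact: continuous_primitive.
- by move=> x _; rewrite derive1E (@derive_val _ _ _ _ _ _ _ (is_derive_primitive x)).
Qed.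

Lemma primitive0 : primitive 0 = 0.
Proof. by rewrite /primitive subrr. Qed.

(** Two antiderivatives differ by a constant; each symmetry of [primitive] below follows by
    exhibiting a second antiderivative. *)
Lemma primitive_const (g : R -> R) :
  (forall x, is_derive x 1 g (f x)) -> forall x, primitive x = g x - g 0.
Proof.
move=> dg x.
have d0 y : is_derive y 1 (primitive - g) 0.
  by apply: (is_derive_eq (is_deriveB (is_derive_primitive y) (dg y))); rewrite subrr.
have := is_derive_0_is_cst x 0 d0.
by rewrite !fctE primitive0 => /eqP; rewrite sub0r subr_eq addrC => /eqP.
Qed.

Lemma primitiveN x : (forall y, f (- y) = f y) -> primitive (- x) = - primitive x.
Proof.
move=> fN; have H y : is_derive y 1 (fun y => - primitive (- y)) (f y).
  have i := @is_derive1_comp _ primitive -%R y _ _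
    (is_derive_primitive (- y)) (is_deriveNid y 1).
  by apply: (is_derive_eq (is_deriveN i)); rewrite mulrN1 opprK fN.
by have := primitive_const H x; rewrite oppr0 primitive0; lra.
Qed.

Lemma primitiveD T x : (forall y, f (y + T) = f y) ->
  primitive (x + T) = primitive x + primitive T.
Proof.
move=> fT; have H y : is_derive y 1 (fun y => primitive (y + T)) (f y).
  have i := @is_derive1_comp _ primitive (fun z => z + T) y _ _
    (is_derive_primitive (y + T))
    (is_deriveD (is_derive_id y 1) (is_derive_cst T y 1)).
  by apply: (is_derive_eq i); rewrite addr0 mulr1 fT.
by have := primitive_const H x; rewrite add0r; lra.
Qed.

Lemma primitive_lt : (forall x, 0 < f x) -> {homo primitive : x y / x < y}.
Proof.
move=> f0 x y xy.
apply: (@gtr0_derive1_lt_cc _ primitive x y) => //.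
- by move=> z _; exact: (@ex_derive _ _ _ _ _ _ _ (is_derive_primitive z)).
- by move=> z _; rewrite derive1E (@derive_val _ _ _ _ _ _ _ (is_derive_primitive z)).
- exact/continuous_subspaceT/continuous_primitive.
- by rewrite in_itv/= lexx ltW.
- by rewrite in_itv/= lexx ltW.
Qed.

End Primitive.

(** * Symmetries of the arc length of the circle and the measure [mu_p] *)

Section ArcLength.
Context {R : realType}.
Implicit Types p x : R.
Notation mu := (@lebesgue_measure R).

Definition arclen p : R -> R := primitive (speed p).

Variable p : R.
Hypothesis p1 : 1 < p.

Lemma arclen_lt : {homo arclen p : x y / x < y}.
Proof.
by apply: primitive_lt => [|x]; [exact: continuous_speed|exact: speed_gt0].
Qed.

Lemma arclenN x : arclen p (- x) = - arclen p x.
Proof.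
by apply: primitiveN => [|y]; [exact: continuous_speed|exact: speedN].
Qed.

Lemma arclenDpihalf x : arclen p (x + pi / 2) = arclen p x + arclen p (pi / 2).
Proof.
by apply: primitiveD => [|y]; [exact: continuous_speed|exact: speedDpihalf].
Qed.

Lemma arclen0 : arclen p 0 = 0. Proof. exact: primitive0. Qed.

Lemma arclenDpi x : arclen p (x + pi) = arclen p x + 2 * arclen p (pi / 2).
Proof.
have -> : x + pi = x + pi / 2 + pi / 2 by field.
by rewrite !arclenDpihalf; ring.
Qed.

Lemma arclenD2pi x : arclen p (x + 2 * pi) = arclen p x + 4 * arclen p (pi / 2).
Proof.
have -> : x + 2 * pi = x + pi + pi by ring.
by rewrite !arclenDpi; ring.
Qed.

(** The reflection x -> pi/2 - x fixes pi/4, so A(pi/4) = A(pi/2) - A(pi/4). *)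
Lemma arclen_piquarter : arclen p (pi / 4) = arclen p (pi / 2) / 2.
Proof.
have : arclen p (- (pi / 4) + pi / 2) = arclen p (pi / 4) by congr (arclen p _); field.
by rewrite arclenDpihalf arclenN; lra.
Qed.

Lemma is_derive_arc x : is_derive x 1 (arclen p) (speed p x).
Proof. by apply: is_derive_primitive; exact: continuous_speed. Qed.

Lemma integral_speed (a b : R) : a <= b ->
  (\int[mu]_(x in `[a, b]) (speed p x)%:E = (arclen p b - arclen p a)%:E)%E.
Proof. by move=> ab; apply: integral_primitive; [exact: continuous_speed|]. Qed.

Lemma measurable_speed (D : set R) : measurable_fun D (fun x => (speed p x)%:E).
Proof.
have h := continuous_measurable_fun (continuous_speed p1).
by apply: measurable_funTS; apply/measurable_EFinP.
Qed.

Lemma integral_speed_co (a b : R) : a <= b ->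
  (\int[mu]_(x in `[a, b[) (speed p x)%:E = (arclen p b - arclen p a)%:E)%E.
Proof.
move=> ab; rewrite -integral_speed//.
by rewrite integral_itv_bndo_bndc//; exact: measurable_speed.
Qed.

Lemma quadrant_bigcup (S : set R) :
  \big[setU/set0]_(i < 4) (quadrant i `&` S) = `[0, 2 * pi[ `&` S.
Proof.
have p0 := @pi_gt0 R.
rewrite !big_ord_recl big_ord0 setU0 /quadrant/=; apply/seteqP; split => x /=.
  rewrite !in_itv/= /bump/=.
  by case=> [|[|[|]]] [/andP[h1 h2] Sx]; split => //; lra.
rewrite !in_itv/= /bump/= => -[/andP[h1 h2] Sx].
have [|h3] := ltP x (pi / 2); first by left; split => //; lra.
have [|h4] := ltP x pi; first by right; left; split => //; lra.
have [|h5] := ltP x (3 * pi / 2); first by right; right; left; split => //; lra.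
by right; right; right; split => //; lra.
Qed.

(** The quadrants are disjoint and tile [0, 2 pi), so the four integrals merge into one. *)
Lemma mu_pE (U : set (R * R)) :
  measurable (`[0, 2 * pi[ `&` (rho p @^-1` U) : set R) ->
  mu_p p U = (\int[mu]_(x in `[0%R, (2 * pi)%R[ `&` (rho p @^-1` U)) (speed p x)%:E)%E.
Proof.
move=> mU; rewrite -quadrant_bigcup /mu_p ge0_integral_bigsetU//=.
- move=> i; rewrite (_ : quadrant i `&` _ =
      quadrant i `&` (`[0, 2 * pi[ `&` (rho p @^-1` U))).
    by apply: measurableI => //; exact: measurable_itv.
  rewrite setIA; congr (_ `&` _); apply/esym/setIidl => x.
  rewrite /quadrant/= !in_itv/= => /andP[h1 h2].
  have p0 := @pi_gt0 R.
  have i0 : (0 : R) <= i%:R by [].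
  have i4 : i.+1%:R <= 4 :> R by rewrite ler_nat.
  apply/andP; split; nra.
- exact: index_enum_uniq.
- move=> i j _ _ [x [[+ _] [+ _]]].
  rewrite /quadrant/= !in_itv/= => /andP[h1 h2] /andP[h3 h4].
  have p0 : 0 < @pi R / 2 by rewrite divr_gt0 ?pi_gt0.
  apply/val_inj/eqP; rewrite eqn_leq -(ltnS i) -(ltnS j) -!(ltr_nat R).
  (* A common point x satisfies i h <= x < (j+1) h with h = pi/2, hence i <= j; the converse is
     symmetric. *)
  by rewrite -(ltr_pM2r p0) (le_lt_trans h1 h4)/= -(ltr_pM2r p0) (le_lt_trans h3 h2).
- exact: measurable_speed.
- by move=> x _; rewrite lee_fin ltW ?speed_gt0.
Qed.

End ArcLength.

(** * Cost of an exit found at a given angle *)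

Section Geometry.
Context {R : realType}.
Implicit Types p x y t s : R.

Lemma lp_normN p (a : R * R) : lp_norm p (- a) = lp_norm p a.
Proof. by case: a => x y; rewrite /lp_norm/= !normrN. Qed.

Lemma lp_distC p (a b : R * R) : lp_dist p a b = lp_dist p b a.
Proof. by rewrite /lp_dist -lp_normN opprB. Qed.

Lemma lp_norm0 p : p != 0 -> lp_norm p (0, 0) = 0 :> R.
Proof. by move=> p0; rewrite /lp_norm/= normr0 powR0// addr0 powR0// invr_neq0. Qed.

Lemma lp_norm_ge0 p (a : R * R) : 0 <= lp_norm p a.
Proof. exact: powR_ge0. Qed.

Lemma lp_distxx p (a : R * R) : p != 0 -> lp_dist p a a = 0.
Proof. by move=> p0; rewrite /lp_dist subrr; exact: lp_norm0. Qed.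

Lemma rho_norm p t : p != 0 -> lp_norm p (rho p t) = 1.
Proof.
move=> p0; rewrite rhoE (mulrC (cos t)) (mulrC (sin t)).
rewrite lp_norm_scale ?powR_ge0// lp_normC powRN.
by rewrite -[lp_norm p _]/(N_p p t) N_pE mulVf// gt_eqF// powR_gt0// Dp_gt0.
Qed.

(** The half-angle formula gives sin(x/2)^2 = 0, while sine is positive on (0, pi), where |x/2| lies
    if x is nonzero. *)
Lemma cos_eq1 x : `|x| < 2 * pi -> cos x = 1 -> x = 0.
Proof.
move=> x2 cx; apply/eqP/contraT => x0.
have : 0 < sin `|x / 2|.
  apply: sin_gt0_pi; rewrite normr_gt0 mulf_neq0 ?invr_neq0 ?pnatr_eq0//=.
  by rewrite normrM (@ger0_norm _ 2^-1)// ltr_pdivrMr// mulrC.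
have : sin `|x / 2| ^+ 2 = 0.
  rewrite sin2cos2 cos_norm.
  have := cos_mulr2n (x / 2); rewrite (_ : (x / 2) *+ 2 = x); last first.
    by rewrite -mulr_natr divfK// pnatr_eq0.
  rewrite cx mulr2n; lra.
by move=> /eqP; rewrite sqrf_eq0 => /eqP ->; rewrite ltxx.
Qed.

(** Comparing Euclidean norms shows that the radial factors agree; then sines and cosines agree, and
    cos(s - t) = 1. *)
Lemma rho_inj p s t : `|s - t| < 2 * pi -> rho p s = rho p t -> s = t.
Proof.
move=> st e; move: (congr1 fst e) (congr1 snd e).
rewrite !rhoE [X in X -> _]/= [X in _ -> X]/=.
set k := Dp p s `^ _; set l := Dp p t `^ _ => ec es.
have k0 : 0 < k by rewrite powR_gt0 ?Dp_gt0.
have l0 : 0 < l by rewrite powR_gt0 ?Dp_gt0.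
clearbody k l; have kl : k = l.
  have H (u z : R) : (cos u * z) ^+ 2 + (sin u * z) ^+ 2 = z ^+ 2.
    by rewrite !exprMn -mulrDl cos2Dsin2 mul1r.
  have : k ^+ 2 = l ^+ 2 by rewrite -(H s k) -(H t l) ec es.
  move/eqP; rewrite eqf_sqr => /predU1P[//|/eqP]; lra.
move: ec es; rewrite kl.
have l1 : l != 0 by rewrite gt_eqF.
move=> /(mulIf l1) ec /(mulIf l1) es.
have cst : cos (s - t) = 1 by rewrite cosB ec es -!expr2 cos2Dsin2.
by have /eqP := cos_eq1 st cst; rewrite subr_eq0 => /eqP.
Qed.

Lemma rhoD2pi p t : rho p (t + 2 * pi) = rho p t.
Proof.
rewrite (_ : t + 2 * pi = t + pi + pi); last by ring.
by rewrite !rhoE /Dp !sinDpi !cosDpi !opprK.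
Qed.

(** The arccosine of x/r, r being the Euclidean norm, is the polar angle up to a sign, which is the
    sign of y. *)
Lemma rho_surj p (a : R * R) : p != 0 -> lp_norm p a = 1 ->
  exists2 t, - pi <= t <= pi & rho p t = a.
Proof.
move=> p0; case: a => x y a1.
have r0 : 0 < x ^+ 2 + y ^+ 2.
  rewrite lt_neqAle addr_ge0 ?sqr_ge0// andbT eq_sym.
  rewrite paddr_eq0 ?sqr_ge0// !sqrf_eq0; apply/negP => /andP[/eqP x0 /eqP y0].
  by move: a1; rewrite x0 y0 lp_norm0// => /eqP; rewrite eq_sym oner_eq0.
pose r := Num.sqrt (x ^+ 2 + y ^+ 2).
have rp : 0 < r by rewrite sqrtr_gt0.
have r2 : r ^+ 2 = x ^+ 2 + y ^+ 2 by rewrite sqr_sqrtr// ltW.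
have xr : -1 <= x / r <= 1.
  rewrite -ler_norml normrM normfV (gtr0_norm rp) ler_pdivrMr// mul1r.
  by rewrite -sqrtr_sqr ler_wsqrtr// lerDl sqr_ge0.
pose th := acos (x / r).
have cth : cos th = x / r by rewrite acosK// in_itv.
have sth : sin th = `|y| / r.
  rewrite sin_acos// (_ : 1 - _ = (`|y| / r) ^+ 2).
    by rewrite sqrtr_sqr ger0_norm// divr_ge0// ltW.
  rewrite !exprMn -normrX (@ger0_norm _ (y ^+ 2)) ?sqr_ge0// exprVn r2.
  by field; exact: lt0r_neq0.
have th0 : 0 <= th by exact: acos_ge0.
have thpi : th <= pi by exact: acos_lepi.
have pi0 := @pi_gt0 R.
suff [t tpi [ct st]] : exists2 t, - pi <= t <= pi & cos t = x / r /\ sin t = y / r.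
  (* The point of the circle at angle t is k/r times (x, y); both have [lp_norm] 1, hence k/r =
     1. *)
  exists t => //; have := rho_norm t p0; rewrite rhoE ct st.
  set k := Dp p t `^ _; have k0 : 0 <= k by exact: powR_ge0.
  have kr z : z / r * k = k / r * z by ring.
  by rewrite !kr lp_norm_scale ?divr_ge0 ?(ltW rp)// a1 mulr1 => ->; rewrite !mul1r.
have [y0|y0] := leP 0 y.
  by exists th; [lra|rewrite cth sth ger0_norm].
exists (- th); first lra.
by rewrite cosN sinN cth sth ltr0_norm// mulNr opprK.
Qed.

Lemma straight_end p (a b : R * R) T : lp_dist p a b <= T -> straight p a b T = b.
Proof. by rewrite /straight ltNge => ->. Qed.

(** An arrival strictly before the end would give a + k (b - a) = b with k < 1, hence a = b and
    distance 0. This bounds the evacuation time from below. *)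
Lemma straight_eq_end p (a b : R * R) T : p != 0 -> 0 <= T ->
  straight p a b T = b -> lp_dist p a b <= T.
Proof.
move=> p0 T0; rewrite /straight; case: ltP => // Td h; exfalso.
have d0 : 0 < lp_dist p a b by exact: le_lt_trans Td.
have k1 : 1 - T / lp_dist p a b != 0.
  by rewrite subr_eq0 eq_sym lt_eqF// ltr_pdivrMr// mul1r.
move: k1 h; set k := T / _ => k1 h.
have h' : k *: (b - a) = b - a.
  by apply/eqP; rewrite eq_sym subr_eq [eqbRHS]addrC h.
have : (1 - k) *: (b - a) == 0 by rewrite scalerBl scale1r h' subrr.
rewrite scaler_eq0 (negPf k1)/= subr_eq0 => /eqP ba.
by move: d0; rewrite ba lp_distxx// ltxx.
Qed.

Lemma inf_minimum (S : set R) m : S m -> (forall x, S x -> m <= x) -> inf S = m.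
Proof.
move=> Sm lS; apply/eqP; rewrite eq_le; apply/andP; split.
  by apply: ge_inf => //; exists m.
by apply: lb_le_inf => //; exists m.
Qed.

(** A strictly increasing length leaves t as the only parameter with length l(t), so [xget] returns
    t and not its default. *)
Lemma unit_speedE p (r : R -> R * R) (l : R -> R) t :
  (forall t, 0 <= t -> lp_length p r 0 t = (l t)%:E) ->
  {homo l : x y / x < y} -> 0 <= t -> unit_speed p r (l t) = r t.
Proof.
move=> rl lt_l t0; rewrite /unit_speed; congr r.
apply: xget_unique => [|s [s0]]; first by split => //; exact: rl.
rewrite rl// => -[] e; have [st|st|//] := ltgtP s t.
  by have := lt_l _ _ st; rewrite e ltxx.
by have := lt_l _ _ st; rewrite e ltxx.
Qed.

End Geometry.

(** * Discovery time, evacuation time and worst-case exits of a symmetric search *)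

Section Search.
Context {R : realType}.
Implicit Types t x : R.
Variables p phi : R.
Hypothesis p1 : 1 < p.

Let p_neq0 : p != 0. Proof. by rewrite gt_eqF ?(lt_trans ltr01). Qed.

Lemma is_derive_affine (f : R -> R) (k t df : R) :
  is_derive (phi + k * t) 1 f df ->
  is_derive t 1 (fun s => f (phi + k * s)) (df * k).
Proof.
move=> d; apply: (@is_derive1_comp _ f (fun s => phi + k * s)).
apply: (is_derive_eq (is_deriveD (is_derive_cst phi t 1)
  (is_deriveZ k (is_derive_id t 1)))).
by rewrite add0r; exact: mulr1.
Qed.

Lemma lp_length_rho (k : R) t : `|k| = 1 -> 0 <= t ->
  lp_length p (fun s => rho p (phi + k * s)) 0 t
  = (k * (arclen p (phi + k * t) - arclen p phi))%:E.
Proof.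
move=> k1 t0.
have sE s : lp_speed p (fun s => rho p (phi + k * s)) s = speed p (phi + k * s).
  rewrite /lp_speed !derive1E.
  rewrite (@derive_val _ _ _ _ _ _ _ (is_derive_affine (is_derive_rho1 (phi + k * s) p1))).
  rewrite (@derive_val _ _ _ _ _ _ _ (is_derive_affine (is_derive_rho2 (phi + k * s) p1))).
  rewrite (speedE _ p1).
  have := wp_gt0 p (phi + k * s); move: (wp p _) (spow _ _) (spow _ _) => w a b w0.
  rewrite mulNr lp_normN1 -!mulrA (lp_norm_scale (b * k) (a * k) p_neq0 (ltW w0)).
  by rewrite /lp_norm/= !normrM k1 !mulr1.
have cg : continuous (fun s => speed p (phi + k * s)).
  move=> s; apply: (@continuous_comp _ _ _ (fun s => phi + k * s) (speed p)).
    by apply: continuousD; [exact: cst_continuous|exact: mulrl_continuous].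
  exact: continuous_speed.
have -> : lp_length p (fun s => rho p (phi + k * s)) 0 t =
    (\int[lebesgue_measure]_(s in `[0%R, t]) (speed p (phi + k * s))%:E)%E.
  by apply: eq_integral => s _; rewrite sE.
(* The direction k is 1 or -1, so the chain rule contributes the factor k^2 = 1. *)
have H x : is_derive x 1 (fun s => k * arclen p (phi + k * s)) (speed p (phi + k * x)).
  have d := is_derive_affine (is_derive_arc p1 (phi + k * x)).
  apply: (is_derive_eq (is_deriveZ k d)); rewrite /GRing.scale/=.
  rewrite mulrCA -expr2 -real_normK ?num_real// k1 expr1n mulr1//.
have pE := primitive_const cg H t; rewrite mulr0 addr0 -mulrBr in pE.
have iE := @integral_primitive R (fun s => speed p (phi + k * s)) cg 0 t t0.
rewrite primitive0 in iE.
rewrite subr0 in iE.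
rewrite pE in iE.
exact: iE.
Qed.

(** Mirror symmetry about [phi]: two robots that have turned by the same angle to either side have
    covered the same length. *)
Hypothesis sym : forall t, arclen p (phi + t) + arclen p (phi - t) = 2 * arclen p phi.

Definition search_arc t := arclen p (phi + t) - arclen p phi.

Lemma search_arc_lt : {homo search_arc : x y / x < y}.
Proof. by move=> x y xy; rewrite ltrD2r arclen_lt// ltrD2l. Qed.

Lemma search_arc_le : {homo search_arc : x y / x <= y}.
Proof.
by move=> x y; rewrite le_eqVlt => /predU1P[->//|/search_arc_lt/ltW].
Qed.

Lemma search_arc0 : search_arc 0 = 0.
Proof. by rewrite /search_arc addr0 subrr. Qed.

Lemma is_derive_search_arc t : is_derive t 1 search_arc (speed p (phi + t)).
Proof.
have d := @is_derive1_comp _ (arclen p) (fun s => phi + s) t _ _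
  (is_derive_arc p1 (phi + t)) (is_deriveD (is_derive_cst phi t 1) (is_derive_id t 1)).
apply: (is_derive_eq (is_deriveB d (is_derive_cst (arclen p phi) t 1))).
by rewrite add0r subr0; exact: mulr1.
Qed.

Lemma continuous_search_arc : continuous search_arc.
Proof.
move=> t; apply/differentiable_continuous/derivable1_diffP.
exact: (@ex_derive _ _ _ _ _ _ _ (is_derive_search_arc t)).
Qed.

Lemma search1E t : 0 <= t -> search1 p phi (search_arc t) = rho p (phi + t).
Proof.
move=> t0; rewrite /search1.
rewrite (_ : (fun s => _) = fun s => rho p (phi + 1 * s)); last first.
  by apply/funext => s; rewrite mul1r.
rewrite (@unit_speedE _ _ _ search_arc) ?mul1r//.
  by move=> s s0; rewrite lp_length_rho ?normr1// !mul1r.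
exact: search_arc_lt.
Qed.

Lemma search2E t : 0 <= t -> search2 p phi (search_arc t) = rho p (phi - t).
Proof.
move=> t0; rewrite /search2.
rewrite (_ : (fun s => _) = fun s => rho p (phi + (-1) * s)); last first.
  by apply/funext => s; rewrite mulN1r.
rewrite (@unit_speedE _ _ _ search_arc) ?mulN1r//.
  move=> s s0; rewrite lp_length_rho ?normrN1//; congr (_%:E).
  by rewrite !mulN1r /search_arc; have := sym s; lra.
exact: search_arc_lt.
Qed.

Lemma search_arc_surj t x : 0 <= t -> 0 <= x <= search_arc t ->
  exists2 s, 0 <= s <= t & x = search_arc s.
Proof.
move=> t0 /andP[x0 xt].
have cL : {within `[0, t], continuous search_arc}.
  exact/continuous_subspaceT/continuous_search_arc.
have [|s] := IVT t0 cL (v := x).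
  rewrite search_arc0 min_l ?max_r ?x0 ?xt//; exact: (le_trans x0 xt).
by rewrite in_itv/= => st <-; exists s.
Qed.

(** At a turning angle s < t <= pi, both robots are at angles different from the exit's and less
    than 2 pi away from it, so injectivity of [rho] excludes an earlier discovery. *)
Lemma found_timeE t (exit : R * R) : 0 <= t <= pi ->
  exit = rho p (phi + t) \/ exit = rho p (phi - t) ->
  found_time p phi exit = search_arc t.
Proof.
move=> /andP[t0 tpi] et; apply: inf_minimum.
  split; first by rewrite -search_arc0 search_arc_le.
  by rewrite search1E// search2E//; case: et => ->; [left|right].
move=> x [x0 ex]; rewrite leNgt; apply/negP => xt.
have [|s /andP[s0 st] xE] := @search_arc_surj t x t0; first by rewrite x0 ltW.
have {}st : s < t.
  rewrite lt_neqAle st andbT; apply/eqP => st'.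
  by move: xt; rewrite xE st' ltxx.
have pi0 := @pi_gt0 R.
move: ex; rewrite xE search1E// search2E//.
have H (k l : R) : `|k - l| < 2 * pi -> k != l -> rho p (phi + k) <> rho p (phi + l).
  move=> kl /eqP nkl /rho_inj; rewrite opprD addrACA subrr add0r => /(_ kl).
  by move/addrI.
have H' k l : k < l -> l < k + 2 * pi -> rho p (phi + k) <> rho p (phi + l).
  move=> kl lk; apply: H; last by rewrite lt_eqF.
  by rewrite ltr0_norm; lra.
case: et => ->; case; try by apply: H'; lra.
- by apply/nesym/H'; lra.
- by apply/nesym/H'; lra.
Qed.

Definition search_dist t := lp_dist p (rho p (phi + t)) (rho p (phi - t)).

Lemma evacuation_timeE t (exit : R * R) : 0 <= t <= pi ->
  exit = rho p (phi + t) \/ exit = rho p (phi - t) ->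
  evacuation_time p phi exit = 1 + search_arc t + search_dist t.
Proof.
move=> tpi et; have /andP[t0 _] := tpi.
have ftE := found_timeE tpi et.
have L0 : 0 <= search_arc t by rewrite -search_arc0 search_arc_le.
have d0 : 0 <= search_dist t by exact: lp_norm_ge0.
have e1 : lp_norm p exit = 1 by case: et => ->; exact: rho_norm.
apply: inf_minimum.
  rewrite /mkset /trajectory ftE.
  have h1 : (1 + search_arc t + search_dist t < 1) = false by lra.
  have h2 : (1 + search_arc t + search_dist t < 1 + search_arc t) = false by lra.
  rewrite h1 h2 search1E// search2E//.
  have -> : 1 + search_arc t + search_dist t - (1 + search_arc t) = search_dist t.
    by ring.
  split; first lra.
    apply: straight_end; case: et => ->; first by rewrite lp_distxx.
    exact: lexx.
  apply: straight_end; case: et => ->; last by rewrite lp_distxx.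
  by rewrite lp_distC.
(* Lower bound, phase by phase. Before time 1 the robots have norm T < 1. During the search a robot
   at the exit contradicts the minimality of the discovery time. Afterwards the other robot still
   has to cover the distance [search_dist t]. *)
move=> T [T0]; rewrite /trajectory.
have [T1 h _|T1] := ltP T 1.
  exfalso; move: h; rewrite /straight /lp_dist sub0r lp_normN rho_norm// T1.
  rewrite divr1 add0r subr0 => h; move: e1; rewrite -h.
  case: (rho p phi) (rho_norm phi p_neq0) => a b ab.
  have -> : T *: (a, b) = (T * a, T * b) by [].
  by rewrite (lp_norm_scale _ _ p_neq0 T0) ab; lra.
rewrite ftE; have [T2 h1 _|T2] := ltP T (1 + search_arc t).
  have : found_time p phi exit <= T - 1.
    apply: ge_inf; first by exists 0 => ? [].
    by split; [lra|left].
  by rewrite ftE; lra.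
rewrite search1E// search2E// => h1 h2.
have T3 : 0 <= T - (1 + search_arc t) by lra.
suff : search_dist t <= T - (1 + search_arc t) by lra.
case: et => e.
  by rewrite /search_dist lp_distC -e; exact: straight_eq_end h2.
by rewrite /search_dist -e; exact: straight_eq_end h1.
Qed.

(** With u in [-pi, pi] an angle of the exit, u - phi lies in [-2 pi, pi]. The three cases are a
    nonnegative difference, one in [-pi, 0), and one below -pi, to which 2 pi is added. *)
Lemma exit_angle (exit : R * R) : 0 <= phi <= pi -> lp_norm p exit = 1 ->
  exists2 t, 0 <= t <= pi & exit = rho p (phi + t) \/ exit = rho p (phi - t).
Proof.
move=> phipi e1; have [u upi ru] := rho_surj p_neq0 e1.
have pi0 := @pi_gt0 R.
have [h|h] := leP phi u.
  exists (u - phi); first lra.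
  by left; rewrite addrCA subrr addr0.
have [h'|h'] := leP (- pi) (u - phi).
  exists (phi - u); first lra.
  by right; rewrite opprB addrCA subrr addr0.
exists (u - phi + 2 * pi); first lra.
left; have -> : phi + (u - phi + 2 * pi) = u + 2 * pi by ring.
by rewrite rhoD2pi.
Qed.

(** The explored angles form [phi - t, phi + t]; since phi <= t, the negative part is shifted by 2
    pi to the end of [0, 2 pi). *)
Lemma preimage_explored t : 0 <= phi <= t -> t <= pi -> phi + t < 2 * pi ->
  `[0, 2 * pi[ `&` (rho p @^-1` explored p phi (search_arc t)) =
  `[0, phi + t] `|` (`[phi - t + 2 * pi, 2 * pi[ : set R).
Proof.
move=> /andP[phi0 phit] tpi pt; have pi0 := @pi_gt0 R.
have t0 : 0 <= t by lra.
apply/seteqP; split => x /=.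
  rewrite !in_itv/= => -[/andP[x0 x2]] ex.
  have {ex} [u ut xu] : exists2 u, - t <= u <= t & rho p (phi + u) = rho p x.
    case: ex => -[y]; rewrite /= in_itv/=.
      move=> /(search_arc_surj t0)[u ut ->]; have u0 : 0 <= u by lra.
      by rewrite (search1E u0) => e; exists u; [lra|exact: e].
    move=> /(search_arc_surj t0)[u ut ->]; have u0 : 0 <= u by lra.
    by rewrite (search2E u0) => e; exists (- u); [lra|exact: e].
  have [v0|v0] := leP 0 (phi + u).
    left; have <- : phi + u = x; last by lra.
    by apply: rho_inj xu; rewrite ltr_norml; lra.
  have <- : phi + u + 2 * pi = x.
    by apply: (@rho_inj _ p); [rewrite ltr_norml; lra|rewrite rhoD2pi].
  by right; lra.
rewrite !in_itv/=.
have H u : - t <= u <= t -> explored p phi (search_arc t) (rho p (phi + u)).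
  move=> ut; have [u0|u0] := leP 0 u.
    left; exists (search_arc u); last by rewrite (search1E u0).
    by rewrite /= in_itv/= -search_arc0 !search_arc_le//; lra.
  have nu0 : 0 <= - u by lra.
  right; exists (search_arc (- u)); last by rewrite (search2E nu0) opprK.
  by rewrite /= in_itv/= -search_arc0 !search_arc_le//; lra.
case=> hx; (split; first lra).
  have -> : x = phi + (x - phi) by ring.
  by apply: H; lra.
have -> : x = phi + (x - 2 * pi - phi) + 2 * pi by ring.
by rewrite rhoD2pi; apply: H; lra.
Qed.

Lemma mu_p_explored t : 0 <= phi <= t -> t < pi -> phi + t < 2 * pi ->
  mu_p p (explored p phi (search_arc t)) = (2 * search_arc t)%:E.
Proof.
move=> pt tpi pt2; have pi0 := @pi_gt0 R.
have := preimage_explored pt (ltW tpi) pt2 => E.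
rewrite mu_pE// E; last by apply: measurableU; exact: measurable_itv.
rewrite ge0_integral_setU//=; last first.
(* Disjointness amounts to phi + t < phi - t + 2 pi, that is, t < pi. *)
- apply/disj_setPS => x /= []; rewrite !in_itv/= => h1 h2; lra.
- by move=> x _; rewrite lee_fin ltW ?speed_gt0.
- exact: measurable_speed.
rewrite integral_speed//; last by lra.
rewrite integral_speed_co//; last by lra.
rewrite -EFinD arclenD2pi// -[2 * pi]add0r arclenD2pi// arclen0.
by congr (_%:E); have := sym t; rewrite /search_arc; lra.
Qed.

Lemma pi_pE : pi_p p = 2 * arclen p (pi / 2).
Proof.
have pi0 := @pi_gt0 R.
have E : `[0, 2 * pi[ `&` (rho p @^-1` lp_circle p) = [set` `[0, 2 * pi[].
  by apply/setIidl => x _; exact: rho_norm.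
rewrite /pi_p mu_pE// E//; rewrite integral_speed_co; [|exact: p1|lra].
by rewrite -[2 * pi]add0r arclenD2pi// arclen0/=; lra.
Qed.

(** Reduces the problem to a function of one turning angle: as the maximiser t is strict, every
    worst exit is found at angle t, on one side or the other. *)
Theorem worst_case_search t : 0 <= phi <= t -> t < pi -> phi + t < 2 * pi ->
  (forall s, 0 <= s <= pi -> s != t ->
    search_arc s + search_dist s < search_arc t + search_dist t) ->
  worst_case_exits p phi !=set0 /\
  forall exit, worst_case_exits p phi exit ->
    [/\ mu_p p (explored p phi (found_time p phi exit)) = (2 * search_arc t)%:E,
        found_time p phi exit = search_arc t
      & found_distance p phi exit = search_dist t].
Proof.
move=> pt tpi pt2 tmax; have pi0 := @pi_gt0 R.
have tt : 0 <= t <= pi by lra.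
have phipi : 0 <= phi <= pi by lra.
have costE : cost p phi = (1 + search_arc t + search_dist t)%:E.
  apply/eqP; rewrite eq_le; apply/andP; split.
    apply: ge_ereal_sup => _ [exit /= e1 <-].
    have [s spi es] := exit_angle phipi e1.
    rewrite (evacuation_timeE spi es) lee_fin.
    have [->//|st] := eqVneq s t.
    have := tmax _ spi st.
    move: (search_arc s) (search_arc t) (search_dist s) (search_dist t).
    by move=> a b c d; lra.
  apply: ereal_sup_ubound; exists (rho p (phi + t)); first exact: rho_norm.
  by rewrite (evacuation_timeE tt)//; left.
split.
  exists (rho p (phi + t)); split; first exact: rho_norm.
  by rewrite costE (evacuation_timeE tt)//; left.
move=> exit [e1]; rewrite costE.
have [s spi es] := exit_angle phipi e1.
rewrite (evacuation_timeE spi es) => h; have eq := EFin_inj h; clear h.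
have st : s = t.
  apply/eqP/contraT => /(tmax _ spi).
  move: eq; move: (search_arc s) (search_arc t) (search_dist s) (search_dist t).
  by move=> a b c d; lra.
move: es; rewrite st => es; have t0 : 0 <= t by case/andP: tt.
have ft := found_timeE tt es; split.
- by rewrite ft (mu_p_explored pt tpi pt2).
- exact: ft.
- by rewrite /found_distance ft (search1E t0) (search2E t0).
Qed.

End Search.

(** * Sign of the derivative of the cost *)

Section Powers.
Context {R : realType}.
Implicit Types p q x y : R.

Lemma spow_lt q : 0 < q -> {homo (@spow R q) : x y / x < y}.
Proof.
move=> q0.
have pos (x y : R) : 0 <= x -> x < y -> spow q x < spow q y.
  move=> x0 xy; rewrite !(spow_ge0 q0) ?(le_trans x0 (ltW xy))//.
  by apply: gt0_ltr_powR; rewrite ?nnegrE ?(le_trans x0 (ltW xy)).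
move=> x y xy; have [x0|x0] := leP 0 x; first exact: pos.
have [y0|y0] := leP y 0.
  by rewrite -[x]opprK -[y]opprK !(@spowN _ _ (- _)) ltrN2 pos ?oppr_ge0// ltrN2.
have z0 : spow q 0 = 0 :> R by rewrite /spow sgr0 mul0r.
apply: (@lt_trans _ _ 0); last by rewrite -z0; exact: pos.
by rewrite -[x]opprK spowN oppr_lt0 -{1}z0; apply: pos; rewrite ?oppr_gt0.
Qed.

Lemma spowM q x y : 0 < x -> spow q (x * y) = x `^ q * spow q y.
Proof.
move=> x0; rewrite /spow sgrM gtr0_sg// mul1r normrM gtr0_norm// powRM ?(ltW x0)//.
by rewrite mulrCA.
Qed.

Lemma continuous_spow q : 0 < q -> continuous (@spow R q).
Proof.
move=> q0; have q1 : q != 0 by rewrite gt_eqF.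
(* Positive minus negative part: one of the two terms always vanishes, and both are continuous. *)
have E (x : R) : spow q x = `|(x + `|x|) / 2| `^ q - `|(x - `|x|) / 2| `^ q.
  have [x0|x0|->] := ltgtP x 0.
  - rewrite /spow ltr0_sg// ltr0_norm// subrr mul0r normr0 powR0// sub0r mulN1r.
    have -> : (x - - x) / 2 = x by field.
    by rewrite ltr0_norm.
  - rewrite /spow gtr0_sg// gtr0_norm// subrr mul0r normr0 powR0// subr0 mul1r.
    have -> : (x + x) / 2 = x by field.
    by rewrite gtr0_norm.
  - by rewrite /spow sgr0 !(normr0, subr0, addr0, mul0r) subrr.
have -> : spow q = (fun x : R => `|(x + `|x|) / 2| `^ q)
                   - (fun x : R => `|(x - `|x|) / 2| `^ q).
  by apply/funext.
have cn : continuous (fun x : R => `|x|) by exact: (@norm_continuous R R^o).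
have cq := continuous_norm_powR q0.
move=> x.
have c1 : {for x, continuous (fun x : R => (x + `|x|) / 2)}.
  by apply: continuousM; [apply: continuousD; [exact: id|exact: cn]|exact: cst_continuous].
have c2 : {for x, continuous (fun x : R => (x - `|x|) / 2)}.
  by apply: continuousM; [apply: continuousB; [exact: id|exact: cn]|exact: cst_continuous].
exact: (continuousB (continuous_comp c1 (cq _)) (continuous_comp c2 (cq _))).
Qed.

Lemma lt_lp_norm p x y v : 0 < p -> 0 <= v ->
  v `^ p < `|x| `^ p + `|y| `^ p -> v < lp_norm p (x, y).
Proof.
move=> p0 v0 h.
rewrite -[v](powRr1 v0) -(mulfV (lt0r_neq0 p0)) powRrM.
by apply: gt0_ltr_powR; rewrite ?invr_gt0 ?nnegrE ?addr_ge0 ?powR_ge0.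
Qed.

Lemma lp_norm_lt p x y v : 0 < p -> 0 <= v ->
  `|x| `^ p + `|y| `^ p < v `^ p -> lp_norm p (x, y) < v.
Proof.
move=> p0 v0 h.
rewrite -[v](powRr1 v0) -(mulfV (lt0r_neq0 p0)) powRrM.
by apply: gt0_ltr_powR; rewrite ?invr_gt0 ?nnegrE ?addr_ge0 ?powR_ge0.
Qed.

Lemma unimodal_max (F dF : R -> R) a b c :
  (forall x : R, is_derive x 1 F (dF x)) -> a <= c <= b ->
  (forall x, a < x < c -> 0 < dF x) -> (forall x, c < x < b -> dF x < 0) ->
  forall x, a <= x <= b -> x != c -> F x < F c.
Proof.
move=> FdF /andP[ac cb] inc dec x /andP[ax xb] xc.
have dvF y : derivable F y 1 by exact: (@ex_derive _ _ _ _ _ _ _ (FdF y)).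
have F'E y : (F^`())%classic y = dF y by rewrite derive1E (@derive_val _ _ _ _ _ _ _ (FdF y)).
have cF : continuous F.
  by move=> y; apply/differentiable_continuous/derivable1_diffP.
have [xltc|cltx|e] := ltgtP x c; last by rewrite e eqxx in xc.
  apply: (@gtr0_derive1_lt_cc _ F a c) => //.
  - by move=> y; rewrite in_itv/= F'E => /inc.
  - exact: continuous_subspaceT.
  - by rewrite in_itv/= ax ltW.
  - by rewrite in_itv/= ac lexx.
apply: (@ltr0_derive1_lt_cc _ F c b) => //.
- by move=> y; rewrite in_itv/= F'E => /dec.
- exact: continuous_subspaceT.
- by rewrite in_itv/= xb ltW.
- by rewrite in_itv/= cb lexx.
Qed.

End Powers.

(** * The root [w_p] *)

Section RootW.
Context {R : realType}.
Variable p : R.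
Hypothesis p1 : 1 < p.
Let p0 : 0 < p. Proof. exact: lt_trans ltr01 p1. Qed.

(** The power of x increases and that of 1 - x decreases. This gives the uniqueness of the root and,
    later, the sign of the equation on either side of it. *)
Lemma w_equation_lt (x y : R) : 0 <= x -> x < y -> y <= 1 ->
  x `^ p + 1 - 2 * (1 - x) `^ p < y `^ p + 1 - 2 * (1 - y) `^ p.
Proof.
move=> x0 xy y1.
have h1 : x `^ p < y `^ p by apply: gt0_ltr_powR; rewrite ?nnegrE//; lra.
have h2 : (1 - y) `^ p < (1 - x) `^ p.
  by apply: gt0_ltr_powR; rewrite ?nnegrE//; lra.
lra.
Qed.

Lemma w_roots_unique : exists! w, w_roots p w.
Proof.
have p_neq0 : p != 0 by rewrite gt_eqF.
(* The absolute values make h continuous on the whole line without changing it on [0, 1], where it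
   goes from -1 to 2. *)
pose h (x : R) := `|x| `^ p + 1 - 2 * `|1 - x| `^ p.
have ch : {within `[0, 1], continuous h}.
  have cq := continuous_norm_powR p0.
  apply: continuous_subspaceT => x.
  have c1 : {for x, continuous (fun x : R => 1 - x)}.
    by apply: continuousB; [exact: cst_continuous|exact: id].
  have c2 := continuous_comp c1 (cq (1 - x)).
  have c3 := cq x.
  suff : {for x, continuous (fun x : R => `|x| `^ p + 1 - 2 * `|1 - x| `^ p)} by [].
  apply: continuousB; first by apply: continuousD; [exact: c3|exact: cst_continuous].
  by apply: continuousM; [exact: cst_continuous|exact: c2].
have h0 : h 0 = - 1 by rewrite /h normr0 subr0 normr1 powR0// powR1; lra.
have h1 : h 1 = 2 by rewrite /h subrr normr0 normr1 powR0// powR1; lra.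
have [|w] := IVT (@ler01 R) ch (v := 0).
  by rewrite h0 h1 minEle maxEle; case: ifP; lra.
rewrite in_itv/= => /andP[w0 w1] hw.
have {}w0 : 0 < w.
  by rewrite lt_neqAle w0 andbT; apply/eqP => e; move: hw; rewrite -e h0; lra.
have {}w1 : w < 1.
  by rewrite lt_neqAle w1 andbT; apply/eqP => e; move: hw; rewrite e h1; lra.
move: hw; rewrite /h !ger0_norm ?subr_ge0 ?ltW// => hw.
exists w; split; first by split; [rewrite w0 w1|lra].
move=> v [/andP[v0 v1] hv].
have [wv|vw|//] := ltgtP w v.
  by have := w_equation_lt (ltW w0) wv (ltW v1); lra.
by have := w_equation_lt (ltW v0) vw (ltW w1); lra.
Qed.

Lemma w_pP : 0 < w_p p < 1 /\ w_p p `^ p + 1 = 2 * (1 - w_p p) `^ p.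
Proof.
have [w [wr _]] := w_roots_unique.
by apply: (@xgetPex _ 0 (w_roots p)); exists w.
Qed.

End RootW.

(** * The critical angle and the sign of the cost derivative on either side *)

Section CriticalAngle.
Context {R : realType}.
Implicit Types k x : R.
Variable p : R.
Hypothesis p1 : 1 < p.
Let p0 : 0 < p. Proof. exact: lt_trans ltr01 p1. Qed.
Let p_neq0 : p != 0. Proof. by rewrite gt_eqF. Qed.
Let q0 : 0 < p - 1. Proof. by rewrite subr_gt0. Qed.

(* In (pi/2, pi), where [k * spow (p - 1) (cos x) + spow (p - 1) (sin x)] changes
   sign. *)
Definition critical k : R := pi - atan (k `^ (p - 1)^-1).

Lemma critical_bounds k : 0 < k -> pi / 2 < critical k < pi.
Proof.
move=> k0; rewrite /critical.
have h1 := atan_ltpi2 (k `^ (p - 1)^-1).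
have h2 : 0 < atan (k `^ (p - 1)^-1) by rewrite -atan0 lt_atan// powR_gt0.
by lra.
Qed.

Lemma critical_sin_cos k : 0 < k -> exists2 c : R, 0 < c &
  cos (critical k) = - c /\ sin (critical k) = k `^ (p - 1)^-1 * c.
Proof.
move=> k0; set K := k `^ _; pose c := cos (atan K).
have c0 : 0 < c.
  by apply: cos_gt0_pihalf; rewrite atan_gtNpi2 atan_ltpi2.
have sE : sin (atan K) = K * c.
  by rewrite -{2}[K]atanK /tan mulfVK// gt_eqF.
exists c => //; rewrite /critical -/K.
by rewrite addrC cosDpi sinDpi cosN sinN opprK.
Qed.

(** With K = k^(1/(p-1)), the combination K cos x + sin x is a positive multiple of one shifted
    sine, so its sign can be read off from the angle. *)
Lemma sin_critical_sub k x : 0 < k -> exists2 c : R, 0 < c &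
  sin (critical k - x) = c * (k `^ (p - 1)^-1 * cos x + sin x).
Proof.
move=> k0; have [c c0 [cE sE]] := critical_sin_cos k0.
by exists c => //; rewrite sinB cE sE; ring.
Qed.

(** The increasing map [spow (p - 1)] turns -K cos x < sin x into the same inequality between signed
    powers, with K replaced by k. *)
Lemma before_critical k x : 0 < k -> x < critical k < x + pi ->
  0 < k * spow (p - 1) (cos x) + spow (p - 1) (sin x).
Proof.
move=> k0 /andP[xk kx]; have [c c0 sE] := sin_critical_sub x k0.
have : 0 < sin (critical k - x) by apply: sin_gt0_pi; lra.
rewrite sE pmulr_rgt0// => h.
have K0 : 0 < k `^ (p - 1)^-1 by exact: powR_gt0.
have : spow (p - 1) (k `^ (p - 1)^-1 * (- cos x)) < spow (p - 1) (sin x).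
  by apply: spow_lt => //; rewrite mulrN; lra.
rewrite spowM// -powRrM mulVf ?gt_eqF// powRr1 ?ltW// spowN mulrN.
by rewrite -subr_gt0 opprK addrC.
Qed.

Lemma after_critical k x : 0 < k -> critical k < x < critical k + pi ->
  k * spow (p - 1) (cos x) + spow (p - 1) (sin x) < 0.
Proof.
move=> k0 /andP[xk kx]; have [c c0 sE] := sin_critical_sub x k0.
have : 0 < sin (x - critical k) by apply: sin_gt0_pi; lra.
rewrite -opprB sinN sE oppr_gt0 pmulr_rlt0// => h.
have K0 : 0 < k `^ (p - 1)^-1 by exact: powR_gt0.
have : spow (p - 1) (sin x) < spow (p - 1) (k `^ (p - 1)^-1 * (- cos x)).
  by apply: spow_lt => //; rewrite mulrN; lra.
rewrite spowM// -powRrM mulVf ?gt_eqF// powRr1 ?ltW// spowN mulrN.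
by rewrite -subr_lt0 opprK addrC.
Qed.

(** At the critical angle (cos, sin) = c (-1, K), and the scale c cancels in the quotient by N_p. *)
Lemma rho1_critical k : 0 < k ->
  - (rho p (critical k)).1 = (k `^ (p / (p - 1)) + 1) `^ (- p^-1).
Proof.
move=> k0; have [c c0 [cE sE]] := critical_sin_cos k0.
set K := k `^ _ in sE; have K0 : 0 < K by exact: powR_gt0.
have DE : Dp p (critical k) = c `^ p * (K `^ p + 1).
  rewrite /Dp cE sE normrN !gtr0_norm ?mulr_gt0// powRM ?ltW//; ring.
rewrite rhoE/= DE cE mulNr opprK powRM ?powR_ge0 ?addr_ge0 ?powR_ge0//.
rewrite -powRrM mulrN mulfV// powR_inv1 ?ltW// mulrA mulfV ?gt_eqF// mul1r.
by rewrite -powRrM mulrC.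
Qed.

(** Only y < 0 needs work: comparing p-th powers of the norm and of -2y leaves (2^p - 1) (-y)^p <
    x^p, the p-th power of the hypothesis. *)
Lemma minus_sign_pos (x y : R) : 0 < x ->
  0 < (2 `^ p - 1) `^ p^-1 * y + x -> 0 < lp_norm p (x, y) + 2 * y.
Proof.
move=> x0 h; have [y0|y0] := leP 0 y.
  rewrite ltr_pwDl ?mulr_ge0// /lp_norm/= powR_gt0//.
  by rewrite ltr_pwDl ?powR_ge0// powR_gt0// normr_gt0 gt_eqF.
have c0 : 0 <= 2 `^ p - 1 :> R.
  have : 2 <= 2 `^ p :> R by apply: le1r_powR; [lra|exact: ltW].
  lra.
rewrite -(opprK (2 * y)) subr_gt0 -mulrN; apply: lt_lp_norm => //; first lra.
rewrite powRM ?oppr_ge0 ?ltW// (gtr0_norm x0) (ltr0_norm y0).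
have : ((2 `^ p - 1) `^ p^-1 * (- y)) `^ p < x `^ p.
  by apply: gt0_ltr_powR; rewrite ?nnegrE ?mulr_ge0 ?powR_ge0//; lra.
rewrite powRM ?powR_ge0 ?oppr_ge0 ?ltW// -powRrM mulVf// powRr1//.
by set v := (- y) `^ p; set u := x `^ p; set t := 2 `^ p; lra.
Qed.

Lemma minus_sign_neg (x y : R) : 0 < x ->
  (2 `^ p - 1) `^ p^-1 * y + x < 0 -> lp_norm p (x, y) + 2 * y < 0.
Proof.
move=> x0 h.
have c0 : 0 <= 2 `^ p - 1 :> R.
  have : 2 <= 2 `^ p :> R by apply: le1r_powR; [lra|exact: ltW].
  lra.
have y0 : y < 0.
  rewrite ltNge; apply/negP => y0.
  have : 0 <= (2 `^ p - 1) `^ p^-1 * y by rewrite mulr_ge0 ?powR_ge0.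
  lra.
rewrite -(opprK (2 * y)) subr_lt0 -mulrN; apply: lp_norm_lt => //; first lra.
rewrite powRM ?oppr_ge0 ?ltW// (gtr0_norm x0) (ltr0_norm y0).
have : x `^ p < ((2 `^ p - 1) `^ p^-1 * (- y)) `^ p.
  by apply: gt0_ltr_powR; rewrite ?nnegrE ?mulr_ge0 ?powR_ge0//; lra.
rewrite powRM ?powR_ge0 ?oppr_ge0 ?ltW// -powRrM mulVf// powRr1//.
by set v := (- y) `^ p; set u := x `^ p; set t := 2 `^ p; lra.
Qed.

Lemma root2E (v : R) : 0 <= v -> (2 `^ p^-1 * v) `^ p = 2 * v `^ p.
Proof. by move=> v0; rewrite powRM ?powR_ge0// -powRrM mulVf// powRr1. Qed.

(** If x + y < 0, then y < 0 < x; dividing p-th powers by (-y)^p leaves 2 (1 - r)^p < r^p + 1 for r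
    = x/(-y), which holds because w_p < r < 1. *)
Lemma plus_sign_pos (x y : R) : 0 < lp_norm p (x, y) -> 0 < w_p p * y + x ->
  0 < lp_norm p (x, y) + 2 `^ p^-1 * (x + y).
Proof.
move=> n0 h; have [w01 wE] := w_pP p1; have /andP[w0 w1] := w01.
have [xy0|xy0] := leP 0 (x + y).
  by rewrite ltr_pwDl// mulr_ge0 ?powR_ge0.
have y0 : y < 0 by nra.
have x0 : 0 < x by nra.
rewrite -(opprK (2 `^ p^-1 * _)) subr_gt0 -mulrN; apply: lt_lp_norm => //.
  by rewrite mulr_ge0 ?powR_ge0//; lra.
rewrite root2E; last by lra.
rewrite (gtr0_norm x0) (ltr0_norm y0).
have u0 : 0 < - y by lra.
have -> : - (x + y) = (- y) * (1 - x / (- y)) by field; lra.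
have -> : x `^ p = (- y) `^ p * (x / (- y)) `^ p.
  by rewrite -powRM ?divr_ge0 ?ltW// mulrC divfK// gt_eqF.
have r1 : x / - y < 1 by rewrite ltr_pdivrMr// mul1r; lra.
have rw : w_p p < x / - y by rewrite ltr_pdivlMr//; lra.
rewrite (@powRM _ (- y) (1 - x / - y)) ?(ltW u0)//; last by lra.
have := w_equation_lt p1 (ltW w0) rw (ltW r1); rewrite wE subrr => d.
have := mulr_gt0 (powR_gt0 p u0) d.
set A := (x / - y) `^ p; set B := (1 - _) `^ p; set U := (- y) `^ p; lra.
Qed.

Lemma plus_sign_neg (x y : R) : y < 0 -> y < x -> w_p p * y + x < 0 ->
  lp_norm p (x, y) + 2 `^ p^-1 * (x + y) < 0.
Proof.
move=> y0 yx h; have [w01 wE] := w_pP p1; have /andP[w0 w1] := w01.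
have u0 : 0 < - y by lra.
have xy0 : x + y < 0 by nra.
rewrite -(opprK (2 `^ p^-1 * _)) subr_lt0 -mulrN; apply: lp_norm_lt => //.
  by rewrite mulr_ge0 ?powR_ge0//; lra.
rewrite root2E; last by lra.
rewrite (ltr0_norm y0); have [x0|x0] := leP 0 x.
  rewrite (ger0_norm x0).
  have -> : - (x + y) = (- y) * (1 - x / (- y)) by field; lra.
  have -> : x `^ p = (- y) `^ p * (x / (- y)) `^ p.
    by rewrite -powRM ?(ltW u0) ?divr_ge0 ?(ltW u0)// mulrC divfK// gt_eqF.
  have rw : x / - y < w_p p by rewrite ltr_pdivrMr//; lra.
  have r0 : 0 <= x / - y by rewrite divr_ge0// ltW.
  rewrite (@powRM _ (- y) (1 - x / - y)) ?(ltW u0)//; last by lra.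
  have := w_equation_lt p1 r0 rw (ltW w1); rewrite wE subrr => d.
  have U0 := powR_gt0 p u0; have := d; rewrite -(pmulr_rlt0 _ U0).
  set A := (x / - y) `^ p; set B := (1 - _) `^ p; set U := (- y) `^ p; lra.
(* Here both are negative with |x| < |y| < |x + y|, so each p-th power on the left is below that of
   |x + y|. *)
rewrite (ltr0_norm x0).
have h1 : (- x) `^ p < (- y) `^ p by apply: gt0_ltr_powR; rewrite ?nnegrE//; lra.
have h2 : (- y) `^ p < (- (x + y)) `^ p.
  by apply: gt0_ltr_powR; rewrite ?nnegrE//; lra.
lra.
Qed.

End CriticalAngle.

(** * The arc length as an integral over the abscissa *)

Section ArcDensity.
Context {R : realType}.
Implicit Types x y : R.
Variable p : R.
Hypothesis p1 : 1 < p.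
Let p0 : 0 < p. Proof. exact: lt_trans ltr01 p1. Qed.
Let p_neq0 : p != 0. Proof. by rewrite gt_eqF. Qed.
Let q0 : 0 < p - 1. Proof. by rewrite subr_gt0. Qed.

(* The variable z of [arc_density] on the second quadrant. *)
Definition abscissa x : R := - (rho p x).1.

Lemma is_derive_abscissa x :
  is_derive x 1 abscissa (wp p x * spow (p - 1) (sin x)).
Proof. by apply: (is_derive_eq (is_deriveN (is_derive_rho1 x p1))); rewrite opprK. Qed.

Lemma sin_gt0_quadrant2 x : pi / 2 <= x < pi -> 0 < sin x.
Proof. by move=> xpi; apply: sin_gt0_pi; have := @pi_gt0 R; lra. Qed.

Lemma cos_le0_quadrant2 x : pi / 2 <= x < pi -> cos x <= 0.
Proof.
move=> xpi; have -> : x = (x - pi / 2) + pi / 2 by ring.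
by rewrite cosDpihalf oppr_le0; apply: sin_ge0_pi; have := @pi_gt0 R; lra.
Qed.

Lemma abscissaE x : pi / 2 <= x < pi -> abscissa x = `|cos x| * Dp p x `^ (- p^-1).
Proof.
by move=> xpi; rewrite /abscissa rhoE/= -mulNr ler0_norm ?cos_le0_quadrant2.
Qed.

Lemma Dp_root x : (Dp p x `^ (- p^-1)) `^ p = (Dp p x)^-1.
Proof.
by rewrite -powRrM mulNr mulVf// powR_inv1// ltW// Dp_gt0.
Qed.

Lemma one_sub_abscissa x : pi / 2 <= x < pi ->
  1 - abscissa x `^ p = (sin x * Dp p x `^ (- p^-1)) `^ p.
Proof.
move=> xpi; have s0 := sin_gt0_quadrant2 xpi; have D0 := Dp_gt0 p x.
rewrite abscissaE// !powRM ?powR_ge0 ?(ltW s0)// Dp_root.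
have DE : Dp p x = sin x `^ p + `|cos x| `^ p by rewrite /Dp gtr0_norm.
have : Dp p x != 0 by rewrite gt_eqF.
rewrite DE; set a := sin x `^ p; set b := _ `^ p => ab.
by field.
Qed.

Lemma rho2E x : pi / 2 <= x < pi -> (rho p x).2 = (1 - abscissa x `^ p) `^ p^-1.
Proof.
move=> xpi; have s0 := sin_gt0_quadrant2 xpi.
rewrite one_sub_abscissa// -powRrM mulfV// powRr1 ?mulr_ge0 ?powR_ge0 ?(ltW s0)//.
by rewrite rhoE.
Qed.

Lemma arc_density_speed x : pi / 2 <= x < pi ->
  arc_density p (abscissa x) * (wp p x * spow (p - 1) (sin x)) = speed p x.
Proof.
move=> xpi; have s0 := sin_gt0_quadrant2 xpi.
rewrite (speedE _ p1) /arc_density (one_sub_abscissa xpi) (abscissaE xpi).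
set E := Dp p x `^ (- p^-1); have E0 : 0 < E by rewrite powR_gt0 ?Dp_gt0.
have -> : p ^+ 2 - p = (p - 1) * p by ring.
rewrite -[(_ `^ p) `^ (1 - p)]powRrM.
have -> : p * (1 - p) = - ((p - 1) * p) by ring.
rewrite powRN ![_ `^ ((p - 1) * p)]powRrM.
rewrite !powRM ?powR_ge0 ?(ltW s0) ?(ltW E0)//.
rewrite /lp_norm/= !norm_spow// (gtr0_norm s0) (spow_gt0 _ s0).
set C := `|cos x| `^ (p - 1); set S := sin x `^ (p - 1); set e := E `^ (p - 1).
have S0 : 0 < S by exact: powR_gt0.
have C0 : 0 <= C by exact: powR_ge0.
have e0 : 0 < e `^ p by exact/powR_gt0/powR_gt0.
have Sp0 : 0 < S `^ p by exact: powR_gt0.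
have Cp0 : 0 <= C `^ p by exact: powR_ge0.
clearbody C S e.
have iS : S^-1 `^ p = (S `^ p)^-1.
  apply: (mulIf (lt0r_neq0 Sp0)); rewrite mulVf ?gt_eqF//.
  by rewrite -powRM ?invr_ge0 ?(ltW S0)// mulVf ?gt_eqF// powR1.
(* The powers of D cancel: the density is ((C/S)^p + 1)^(1/p), the norm of (S, C) divided by S, and
   the factor S in the derivative of z removes the division. *)
have -> : C `^ p * e `^ p * (S `^ p * e `^ p)^-1 + 1 = (S `^ p + C `^ p) * (S^-1) `^ p.
  rewrite iS; move: (C `^ p) (e `^ p) (S `^ p) e0 Sp0 => u v w v0 w0.
  by field; rewrite !gt_eqF.
rewrite powRM ?powR_ge0 ?addr_ge0 ?(ltW Sp0)// -powRrM mulfV// powRr1 ?invr_ge0 ?ltW//.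
by rewrite mulrCA mulfVK// gt_eqF.
Qed.

Lemma abscissa_lt x y : pi / 2 <= x -> x < y -> y < pi -> abscissa x < abscissa y.
Proof.
move=> x2 xy ypi.
have dA z : derivable abscissa z 1 by exact: (@ex_derive _ _ _ _ _ _ _ (is_derive_abscissa z)).
apply: (@gtr0_derive1_lt_cc _ abscissa x y) => //.
- move=> z; rewrite in_itv/= => zxy.
  rewrite derive1E (@derive_val _ _ _ _ _ _ _ (is_derive_abscissa z)).
  have s0 : 0 < sin z by apply: sin_gt0_quadrant2; lra.
  by rewrite mulr_gt0 ?wp_gt0// spow_gt0// powR_gt0.
- by apply: continuous_subspaceT => z; apply/differentiable_continuous/derivable1_diffP.
- by rewrite in_itv/= lexx ltW.
- by rewrite in_itv/= lexx ltW.
Qed.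

Lemma abscissa_pihalf : abscissa (pi / 2) = 0.
Proof. by rewrite /abscissa rhoE/= cos_pihalf mul0r oppr0. Qed.

Lemma abscissa_lt1 x : pi / 2 <= x < pi -> abscissa x < 1.
Proof.
move=> xpi; have s0 := sin_gt0_quadrant2 xpi.
have h : 0 < 1 - abscissa x `^ p.
  by rewrite one_sub_abscissa// powR_gt0// mulr_gt0// powR_gt0// Dp_gt0.
rewrite ltNge; apply/negP => a1.
have := @le1r_powR R _ p a1 (ltW p1); lra.
Qed.

Lemma continuous_arc_density a b : 0 <= a -> b < 1 ->
  {within `[a, b], continuous (arc_density p)}.
Proof.
move=> a0 b1.
(* The absolute value gives continuity at 0 as well; b < 1 keeps the base 1 - z^p, whose exponent is
   negative, away from 0. *)
pose g x := (`|x| `^ (p ^+ 2 - p) * (1 - `|x| `^ p) `^ (1 - p) + 1) `^ p^-1.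
apply: (@subspace_eq_continuous _ _ _ g).
  move=> x; rewrite inE/= in_itv/= => /andP[ax _].
  by rewrite /g /arc_density ger0_norm// (le_trans a0).
apply: continuous_in_subspaceT => x; rewrite inE/= in_itv/= => /andP[ax xb].
have x0 : 0 <= x by lra.
have xp1 : 0 < 1 - `|x| `^ p.
  rewrite ger0_norm// subr_gt0.
  have : x `^ p < 1 `^ p by apply: gt0_ltr_powR; rewrite ?nnegrE//; lra.
  by rewrite powR1.
have r0 : 0 < p ^+ 2 - p by rewrite (_ : _ - _ = p * (p - 1)) ?mulr_gt0//; ring.
have cr := continuous_norm_powR r0.
have cp := continuous_norm_powR p0.
have c1 : {for x, continuous (fun x : R => 1 - `|x| `^ p)}.
  by apply: continuousB; [exact: cst_continuous|exact: cp].
have c2 : {for x, continuous (fun x : R => (1 - `|x| `^ p) `^ (1 - p))}.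
  exact: (@continuous_powR_pos R R (fun x => 1 - `|x| `^ p) (1 - p) x xp1 c1).
have c3 : {for x, continuous
    (fun x : R => `|x| `^ (p ^+ 2 - p) * (1 - `|x| `^ p) `^ (1 - p) + 1)}.
  apply: continuousD; last exact: cst_continuous.
  by apply: continuousM; [exact: cr|exact: c2].
have g0 : 0 < `|x| `^ (p ^+ 2 - p) * (1 - `|x| `^ p) `^ (1 - p) + 1.
  by rewrite ltr_wpDl// mulr_ge0 ?powR_ge0.
exact: (@continuous_powR_pos R R _ p^-1 x g0 c3).
Qed.

(** Substitution z = [abscissa], increasing on [pi/2, pi), which turns the integrand into the
    speed. *)
Lemma integral_arc_density a b : pi / 2 <= a -> a <= b -> b < pi ->
  \int[lebesgue_measure]_(z in `[abscissa a, abscissa b]) arc_density p z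
  = arclen p b - arclen p a.
Proof.
move=> a2 ab bpi.
have dA z : derivable abscissa z 1 by exact: (@ex_derive _ _ _ _ _ _ _ (is_derive_abscissa z)).
have cA : continuous abscissa.
  by move=> z; apply/differentiable_continuous/derivable1_diffP.
have A'E : (abscissa^`())%classic = (fun z => wp p z * spow (p - 1) (sin z)).
  apply/funext => z.
  by rewrite derive1E (@derive_val _ _ _ _ _ _ _ (is_derive_abscissa z)).
have cs := continuous_spow q0.
have cA' : continuous (abscissa^`())%classic.
  rewrite A'E => z.
  have c1 := continuous_comp (@continuous_sin R z) (cs (sin z)).
  have c2 := continuous_wp p1.
  by apply: continuousM; [exact: c2|exact: c1].
have a0 : 0 <= abscissa a.
  move: a2; rewrite le_eqVlt => /predU1P[<-|a2]; first by rewrite abscissa_pihalf.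
  by rewrite -abscissa_pihalf ltW// abscissa_lt//; lra.
have b1 : abscissa b < 1 by apply: abscissa_lt1; lra.
have sub : (\int[lebesgue_measure]_(z in `[abscissa a, abscissa b]) (arc_density p z)%:E =
    \int[lebesgue_measure]_(z in `[a, b])
      (((arc_density p \o abscissa) * (abscissa^`())%classic) z)%:E)%E.
  apply: integration_by_substitution_increasing.
  - exact: ab.
  - move=> x y; rewrite !in_itv/= => /andP[ax _] /andP[_ yb] xy.
    apply: abscissa_lt => //; [exact: le_trans ax|exact: le_lt_trans bpi].
  - by move=> x _; exact: cA'.
  - apply/cvg_ex; exists ((abscissa^`())%classic a).
    by apply: cvg_at_right_filter; exact: cA'.
  - apply/cvg_ex; exists ((abscissa^`())%classic b).
    by apply: cvg_at_left_filter; exact: cA'.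
  - split; first by move=> x _; exact: dA.
      by apply: cvg_at_right_filter; exact: cA.
    by apply: cvg_at_left_filter; exact: cA.
  - exact: continuous_arc_density.
have E : (\int[lebesgue_measure]_(z in `[a, b])
      (((arc_density p \o abscissa) * (abscissa^`())%classic) z)%:E =
      \int[lebesgue_measure]_(z in `[a, b]) (speed p z)%:E)%E.
  apply: eq_integral => z; rewrite inE/= in_itv/= => zab.
  have zpi : pi / 2 <= z < pi by clear -a2 bpi zab; lra.
  by rewrite -(arc_density_speed zpi) A'E.
by rewrite /Rintegral sub E (integral_speed p1 ab).
Qed.

End ArcDensity.

(** * The two searches *)

Section WorstCase.
Context {R : realType}.
Implicit Types x t : R.
Variable p : R.
Hypothesis p1 : 1 < p.
Let p0 : 0 < p. Proof. exact: lt_trans ltr01 p1. Qed.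
Let p_neq0 : p != 0. Proof. by rewrite gt_eqF. Qed.
Let q0 : 0 < p - 1. Proof. by rewrite subr_gt0. Qed.

Lemma search_dist_0 t : 0 <= t <= pi -> search_dist p 0 t = 2 * (rho p t).2.
Proof.
move=> tpi; have s0 : 0 <= sin t by exact: sin_ge0_pi.
rewrite /search_dist add0r sub0r !rhoE /lp_dist DpN cosN sinN.
set E := _ `^ _; have E0 : 0 <= E by exact: powR_ge0.
have -> : (cos t * E, sin t * E) - (cos t * E, - sin t * E) = (0, 2 * (sin t * E)).
  by congr pair => /=; ring.
rewrite /lp_norm/= normr0 powR0// add0r -powRrM mulfV// powRr1//.
by rewrite ger0_norm// mulr_ge0// mulr_ge0.
Qed.

Lemma sin_ge_cos x : pi / 4 <= x <= pi / 4 + pi -> cos x <= sin x.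
Proof.
move=> xpi; have pi0 := @pi_gt0 R.
have c0 : 0 < cos (pi / 4 : R) by apply: cos_gt0_pihalf; lra.
have sc : sin (pi / 4) = cos (pi / 4) :> R.
  by rewrite -[LHS]cosBpihalf -cosN; congr cos; field.
have : 0 <= sin (x - pi / 4) by apply: sin_ge0_pi; lra.
by rewrite sinB sc -mulrBl pmulr_lge0// subr_ge0.
Qed.

Lemma sin_gt_cos x : pi / 4 < x < pi / 4 + pi -> cos x < sin x.
Proof.
move=> xpi; have pi0 := @pi_gt0 R.
have c0 : 0 < cos (pi / 4 : R) by apply: cos_gt0_pihalf; lra.
have sc : sin (pi / 4) = cos (pi / 4) :> R.
  by rewrite -[LHS]cosBpihalf -cosN; congr cos; field.
have : 0 < sin (x - pi / 4) by apply: sin_gt0_pi; lra.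
by rewrite sinB sc -mulrBl pmulr_lgt0// subr_gt0.
Qed.

(** The robots are reflections in the diagonal, so their coordinates are swapped and their
    difference is (-d, d), of norm 2^(1/p) d. *)
Lemma search_dist_piquarter t : 0 <= t <= pi -> search_dist p (pi / 4) t =
  2 `^ p^-1 * ((rho p (pi / 4 + t)).2 - (rho p (pi / 4 + t)).1).
Proof.
move=> tpi; set a := pi / 4 + t.
have sc : cos a <= sin a by apply: sin_ge_cos; rewrite /a; lra.
rewrite /search_dist -/a.
have -> : pi / 4 - t = - a + pi / 2 by rewrite /a; field.
rewrite !rhoE /lp_dist DpDpihalf DpN sinDpihalf cosDpihalf cosN sinN opprK.
set E := _ `^ _; have E0 : 0 <= E by exact: powR_ge0.
have d0 : 0 <= sin a * E - cos a * E by rewrite -mulrBl mulr_ge0 ?subr_ge0.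
have -> : (cos a * E, sin a * E) - (sin a * E, cos a * E) =
    (- (sin a * E - cos a * E), sin a * E - cos a * E).
  by congr pair => /=; ring.
rewrite /=; move: (_ - _) d0 => d d0.
rewrite lp_normN1 /lp_norm/= ger0_norm//.
have -> : d `^ p + d `^ p = 2 * d `^ p by ring.
by rewrite powRM ?powR_ge0// -powRrM mulfV// powRr1.
Qed.

Lemma minus_ratio_gt0 : 0 < (2 `^ p - 1) `^ p^-1 :> R.
Proof.
apply: powR_gt0; have : 2 <= 2 `^ p :> R by apply: le1r_powR; [lra|exact: ltW].
lra.
Qed.

Lemma s_minusE : abscissa p (critical p ((2 `^ p - 1) `^ p^-1)) = s_minus p.
Proof.
rewrite /abscissa (rho1_critical p1 minus_ratio_gt0) /s_minus -powRrM.
by have -> : p^-1 * (p / (p - 1)) = (p - 1)^-1 by rewrite mulrA mulVf// mul1r.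
Qed.

Lemma s_plusE : abscissa p (critical p (w_p p)) = s_plus p.
Proof.
have [/andP[w0 _] _] := w_pP p1.
by rewrite /abscissa (rho1_critical p1 w0).
Qed.

Lemma critical1 : critical p 1 = 3 * pi / 4 :> R.
Proof. by rewrite /critical powR1 atan1; field. Qed.

(** Identifies the lower limit of the integral in [e_plus] with an angle, the critical one for k =
    1. *)
Lemma abscissa_3piquarter : abscissa p (3 * pi / 4) = 2 `^ (- p^-1).
Proof.
rewrite -critical1 /abscissa (rho1_critical p1 ltr01) powR1.
by congr (_ `^ _); ring.
Qed.

Lemma arclen_sym0 t : arclen p (0 + t) + arclen p (0 - t) = 2 * arclen p 0.
Proof. by rewrite add0r sub0r arclenN// arclen0 subrr mulr0. Qed.

Lemma arclen_sym_piquarter t :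
  arclen p (pi / 4 + t) + arclen p (pi / 4 - t) = 2 * arclen p (pi / 4).
Proof.
have -> : pi / 4 - t = - (pi / 4 + t) + pi / 2 by field.
rewrite arclenDpihalf// arclenN// arclen_piquarter//.
by move: (arclen p _) (arclen p (pi / 2)) => u v; lra.
Qed.

Lemma e_minusE :
  e_minus p = 2 * arclen p (critical p ((2 `^ p - 1) `^ p^-1)).
Proof.
set c := critical p _.
have := critical_bounds p minus_ratio_gt0; rewrite -/c => /andP[c2 cpi].
rewrite /e_minus -s_minusE -/c -(abscissa_pihalf p).
rewrite (integral_arc_density p1 (lexx _) (ltW c2) cpi) (pi_pE p1).
by ring.
Qed.

Lemma w_critical_bounds : 3 * pi / 4 < critical p (w_p p) < pi.
Proof.
have [/andP[w0 w1] _] := w_pP p1.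
have /andP[_ ->] := critical_bounds p w0; rewrite andbT -critical1 /critical.
rewrite ltrD2l ltrN2 lt_atan//.
by apply: gt0_ltr_powR; rewrite ?invr_gt0 ?nnegrE ?(ltW w0).
Qed.

(** The integral is A(c) - A(3 pi/4), where A(3 pi/4) = 3/2 A(pi/2), and pi_p = 2 A(pi/2). *)
Lemma e_plusE : e_plus p = 2 * arclen p (critical p (w_p p)) - arclen p (pi / 2).
Proof.
set c := critical p _; have := w_critical_bounds; rewrite -/c => /andP[c2 cpi].
have pi0 := @pi_gt0 R.
have h : pi / 2 <= 3 * pi / 4 :> R by lra.
rewrite /e_plus -s_plusE -/c -abscissa_3piquarter.
rewrite (integral_arc_density p1 h (ltW c2) cpi) (pi_pE p1).
have -> : 3 * pi / 4 = pi / 4 + pi / 2 :> R by field.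
rewrite arclenDpihalf// arclen_piquarter//.
by move: (arclen p c) (arclen p (pi / 2)) => u v; field.
Qed.

Lemma worst_case_minus : worst_case_exits p 0 !=set0 /\
  forall exit : R * R, worst_case_exits p 0 exit ->
    [/\ mu_p p (explored p 0 (found_time p 0 exit)) = (e_minus p)%:E,
        found_time p 0 exit = e_minus p / 2
      & found_distance p 0 exit = gamma_minus p].
Proof.
have pi0 := @pi_gt0 R.
set k : R := (2 `^ p - 1) `^ p^-1.
have k0 : 0 < k by exact: minus_ratio_gt0.
have := critical_bounds p k0; set c := critical p k => /andP[c2 cpi].
have arcE t : search_arc p 0 t = arclen p t by rewrite /search_arc add0r arclen0 subr0.
have Fmax s : 0 <= s <= pi -> s != c ->
    search_arc p 0 s + search_dist p 0 s < search_arc p 0 c + search_dist p 0 c.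
  move=> spi sc; have cc : 0 <= c <= pi by lra.
  rewrite !arcE !search_dist_0//; move: s spi sc.
  (* After [wp] is factored out, the derivative of this cost is the expression of [minus_sign_pos]
     and [minus_sign_neg]. *)
  apply: (@unimodal_max _ (fun t => arclen p t + 2 * (rho p t).2)
    (fun t => speed p t + 2 * (wp p t * spow (p - 1) (cos t)))).
  - move=> x; apply: is_deriveD; first exact: is_derive_arc.
    by apply: is_deriveZ; exact: is_derive_rho2.
  - exact: cc.
  - move=> x xc; rewrite (speedE _ p1) mulrCA -mulrDr mulr_gt0 ?wp_gt0//.
    have s0 : 0 < sin x by apply: sin_gt0_pi; lra.
    apply: (minus_sign_pos p1); first by rewrite spow_gt0// powR_gt0.
    by apply: (before_critical p1 k0); rewrite -/c; lra.
  - move=> x xc; rewrite (speedE _ p1) mulrCA -mulrDr pmulr_rlt0 ?wp_gt0//.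
    have s0 : 0 < sin x by apply: sin_gt0_pi; lra.
    apply: (minus_sign_neg p1); first by rewrite spow_gt0// powR_gt0.
    by apply: (after_critical p1 k0); rewrite -/c; lra.
have h1 : 0 <= (0 : R) <= c by lra.
have h2 : 0 + c < 2 * pi by lra.
have [ne H] := worst_case_search p1 arclen_sym0 h1 cpi h2 Fmax.
split => // exit /H [-> -> ->].
have cc : 0 <= c <= pi by lra.
have c3 : pi / 2 <= c < pi by lra.
split.
- by rewrite arcE e_minusE.
- by rewrite arcE e_minusE mulrAC mulfV ?mul1r// pnatr_eq0.
- by rewrite (search_dist_0 cc) (rho2E p1 c3) s_minusE.
Qed.

Lemma worst_case_plus : worst_case_exits p (pi / 4) !=set0 /\
  forall exit : R * R, worst_case_exits p (pi / 4) exit ->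
    [/\ mu_p p (explored p (pi / 4) (found_time p (pi / 4) exit)) = (e_plus p)%:E,
        found_time p (pi / 4) exit = e_plus p / 2
      & found_distance p (pi / 4) exit = gamma_plus p].
Proof.
have pi0 := @pi_gt0 R.
have [/andP[w0 w1] _] := w_pP p1.
have := w_critical_bounds; set c := critical p _ => /andP[c2 cpi].
(* The cost up to a constant, as a function of the absolute angle of the first robot; the turning
   angle is recovered by subtracting pi/4. *)
pose F t := arclen p t + 2 `^ p^-1 * ((rho p t).2 - (rho p t).1).
have Fmax x : pi / 4 <= x <= pi / 4 + pi -> x != c -> F x < F c.
  move: x; apply: (@unimodal_max _ F (fun t => speed p t + 2 `^ p^-1 *
      (wp p t * spow (p - 1) (cos t) - - (wp p t * spow (p - 1) (sin t))))).
  - move=> x; apply: is_deriveD; first exact: is_derive_arc.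
    apply: is_deriveZ; apply: is_deriveB; first exact: is_derive_rho2.
    exact: is_derive_rho1.
  - by lra.
  - move=> x xc; rewrite (speedE _ p1) opprK -mulrDr mulrCA -mulrDr mulr_gt0 ?wp_gt0//.
    rewrite [X in _ * X]addrC; apply: (plus_sign_pos p1).
      by rewrite /lp_norm powR_gt0//; exact: speed_sum_gt0.
    by apply: (before_critical p1 w0); rewrite -/c; lra.
  - move=> x xc; rewrite (speedE _ p1) opprK -mulrDr mulrCA -mulrDr pmulr_rlt0 ?wp_gt0//.
    rewrite [X in _ * X]addrC; apply: (plus_sign_neg p1).
    (* Past c > 3 pi/4 the angle x - pi lies in (-pi/4, pi/4), which makes cos x negative. *)
    + have -> : 0 = spow (p - 1) 0 :> R by rewrite /spow sgr0 mul0r.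
      apply: spow_lt => //; have -> : x = x - pi + pi by ring.
      by rewrite cosDpi oppr_lt0; apply: cos_gt0_pihalf; lra.
    + by apply: spow_lt => //; apply: sin_gt_cos; lra.
    + by apply: (after_critical p1 w0); rewrite -/c; lra.
pose t0 := c - pi / 4.
have cE : pi / 4 + t0 = c by rewrite /t0; ring.
have t0pi : 0 <= t0 <= pi by rewrite /t0; lra.
have FE t : 0 <= t <= pi -> search_arc p (pi / 4) t + search_dist p (pi / 4) t =
    F (pi / 4 + t) - arclen p (pi / 4).
  by move=> tpi; rewrite search_dist_piquarter// /search_arc addrAC.
have tmax s : 0 <= s <= pi -> s != t0 ->
    search_arc p (pi / 4) s + search_dist p (pi / 4) s <
    search_arc p (pi / 4) t0 + search_dist p (pi / 4) t0.
  move=> spi st; rewrite !FE// ltrD2r cE; apply: Fmax; first by lra.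
  by rewrite -cE (inj_eq (addrI _)).
have h1 : 0 <= (pi / 4 : R) <= t0 by rewrite /t0; lra.
have h2 : t0 < pi by rewrite /t0; lra.
have h3 : pi / 4 + t0 < 2 * pi by rewrite cE; lra.
have [ne H] := worst_case_search p1 arclen_sym_piquarter h1 h2 h3 tmax.
split => // exit /H [-> -> ->].
have eE : 2 * search_arc p (pi / 4) t0 = e_plus p.
  rewrite /search_arc cE e_plusE -/c arclen_piquarter//.
  by move: (arclen p c) (arclen p _) => u v; field.
have c3 : pi / 2 <= c < pi by lra.
split.
- by rewrite eE.
- by rewrite -eE mulrAC mulfV ?mul1r// pnatr_eq0.
- rewrite search_dist_piquarter// cE /gamma_plus (rho2E p1 c3).
  by rewrite -[- (rho p c).1]/(abscissa p c) s_plusE.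
Qed.

(** The arc length A is strictly increasing with A(pi) = 2 A(pi/2). In the first case pi/2 < c < pi
    suffices; in the second the lower bound uses 3 pi/4 < c, as 2 A(3 pi/4) - A(pi/2) = pi_p. *)
Lemma e_p_bounds : pi_p p < e_p p <= 2 * pi_p p.
Proof.
have pi0 := @pi_gt0 R.
have a1 x : x < pi -> arclen p x < 2 * arclen p (pi / 2).
  by move=> /(arclen_lt p1); have := arclenDpi p1 0; rewrite add0r arclen0 add0r => ->.
rewrite (pi_pE p1) /e_p; case: ifP => _.
  rewrite e_minusE; set c := critical p _.
  have := critical_bounds p minus_ratio_gt0; rewrite -/c => /andP[c2 /a1].
  have := arclen_lt p1 c2.
  move: (arclen p c) (arclen p _) => u v; lra.
rewrite e_plusE; set c := critical p _.
have := w_critical_bounds; rewrite -/c => /andP[c2 /a1].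
have q1 : 0 < arclen p (pi / 2) by rewrite -(arclen0 p) arclen_lt// divr_gt0.
have := arclen_lt p1 c2.
have -> : 3 * pi / 4 = pi / 4 + pi / 2 :> R by field.
rewrite arclenDpihalf// arclen_piquarter//; move: q1.
move: (arclen p c) (arclen p _) => u v; lra.
Qed.

End WorstCase.

Theorem theorem2 (R : realType) :
  [/\ forall p : R, 1 < p -> exists! w, w_roots p w,
      forall p : R, 1 < p <= 2 ->
        worst_case_exits p 0 !=set0 /\
        forall exit, worst_case_exits p 0 exit ->
          [/\ mu_p p (explored p 0 (found_time p 0 exit)) = (e_minus p)%:E,
              found_time p 0 exit = e_minus p / 2
            & found_distance p 0 exit = gamma_minus p],
      forall p : R, 2 <= p ->
        worst_case_exits p (pi / 4) !=set0 /\
        forall exit, worst_case_exits p (pi / 4) exit ->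
          [/\ mu_p p (explored p (pi / 4) (found_time p (pi / 4) exit))
                = (e_plus p)%:E,
              found_time p (pi / 4) exit = e_plus p / 2
            & found_distance p (pi / 4) exit = gamma_plus p]
    & forall p : R, 1 < p -> pi_p p < e_p p <= 2 * pi_p p].
Proof.
split=> p.
- exact: w_roots_unique.
- by move=> /andP[p1 _]; exact: worst_case_minus.
- by move=> p2; apply: worst_case_plus; rewrite (lt_le_trans _ p2)// ltr1n.
- exact: e_p_bounds.
Qed.
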